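(* Let $a\in\mathbb{N}$, $b\in\mathbb{Z}$, $c\in\mathbb{R}_{\neq 0}$, $d\in\mathbb{R}$ be constants. Put $g:=(a,b)$, $a':=a/g$, $b':=b/g$, $r_n:=a'n+b'$. Let \[M:=\left\{n\in\mathbb{N}:\ n>\max\Big\{-\frac{b}{a},-\frac{d}{c}\Big\}\ \text{ and }\ \frac{\varphi(an+b)}{cn+d}\leq\frac{a\varphi(g)}{cg}\right\},\] \[R'(a,b):=\{n\in\mathbb{N}_{>-b/a}:\ \tau_g(r_n)\geq 2\},\] \[P(a,b):=\{n\in\mathbb{N}:\ r_n\text{ is prime and } r_n\nmid g\}.\] Clearly $R(a,b)\cup R'(a,b)=\mathbb{N}_{>-b/a}$. Then the following hold. (i) $\#M=\infty$ and \[M=\left\{n\in\mathbb{N}:\ n>-\frac{b}{a}\ \text{ and }\ n\geq\frac{\gamma_g(r_n)\,\varphi(\tau_g(r_n))}{a'}-\frac{d}{c}\right\}.\] (ii) $\#P(a,b)=\infty$ and $P(a,b)\subseteq R'(a,b)$. Furthermore, \[M\cap R(a,b)\neq\emptyset\implies \frac{d}{c}\geq \frac{b}{a}\implies M=\mathbb{N}_{>-b/a}\] and \[M\cap P(a,b)\neq\emptyset\implies \frac{d}{c}\geq\frac{b-g}{a}\implies R'(a,b)\subseteq M.\] (iii) $M=\mathbb{N}_{>-b/a}$ if and only if \[\frac{d}{c}\geq\begin{cases} b/a,&\text{if }\rho(a,b)\geq1,\\ (b-g)/a,&\text{otherwise.}\end{cases}\]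
   Context: $\mathbb{N}$ is the set of positive integers, $\mathbb{N}_{>y}:=\{n\in\mathbb{N}: n>y\}$ for real $y$, $\mathbb{R}_{\neq 0}$ is the set of nonzero real numbers, $\varphi$ is Euler's totient function, $(a,b)=\gcd(a,b)$, and $\mathrm{rad}(n)=\prod_{p\mid n}p$ (product over primes) for a nonzero integer $n$. For a prime $p$ and $k\in\mathbb{N}$, $p^k\,\|\,m$ means $p^k\mid m$ and $p^{k+1}\nmid m$. For integers $m\neq 0$ and $n$, put \[\gamma_n(m):=\prod_{p^k\| m,\ p\mid n}p^k,\qquad \tau_n(m):=\prod_{p^k\| m,\ p\nmid n}p^k.\] For $a\in\mathbb{N}$, $b\in\mathbb{Z}$, with $g=(a,b)$, $a'=a/g$, $b'=b/g$, define \[R(a,b):=\{n\in\mathbb{N}_{>-b/a}:\ \mathrm{rad}(a'n+b')\mid g\},\qquad \rho(a,b):=\#R(a,b),\] where $\rho(a,b)$ may be $\infty$.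
   Formalization: The formal theorem assumes c > 0 instead of c ≠ 0; for c < 0 the claim is false, e.g. a=1, b=0, c=−1, d=0 gives M={1}, and the identity in (i) fails for every c < 0 since clearing denominators reverses the inequality. *)

(* Defs.v *)
From mathcomp Require Export all_boot all_order all_algebra.
From mathcomp Require Export boolp classical_sets cardinality reals
  constructive_ereal counting_measure.

Set Implicit Arguments.
Unset Strict Implicit.
Unset Printing Implicit Defensive.

Import Order.TTheory GRing.Theory Num.Theory.

Local Open Scope classical_set_scope.
Local Open Scope ring_scope.

(* In the mathematics, the set of natural numbers starts at 1; subsets of it
   are represented as sets of nat whose elements are positive. *)
Definition Nabove (R : realType) (y : R) : set nat :=
  [set n | (0 < n)%N /\ y < n%:R].

Definition rad (m : int) : nat := (\prod_(p <- primes `|m|%N) p)%N.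

(* If p is a prime factor of m, then p ^ logn p `|m| is the power of p exactly
   dividing m. The condition on n is stated by divisibility, not by membership
   in primes `|n|, so that n = 0 is handled correctly. *)
Definition gamma (n m : int) : nat :=
  (\prod_(p <- primes `|m|%N | (p%:Z %| n)%Z) p ^ logn p `|m|%N)%N.

Definition tau (n m : int) : nat :=
  (\prod_(p <- primes `|m|%N | ~~ (p%:Z %| n)%Z) p ^ logn p `|m|%N)%N.

Definition gg (a : nat) (b : int) : nat := gcdn a `|b|%N.

Definition aq (a : nat) (b : int) : nat := (a %/ gg a b)%N.

Definition bq (a : nat) (b : int) : int := (b %/ (gg a b)%:Z)%Z.

Definition rn (a : nat) (b : int) (n : nat) : int :=
  (aq a b)%:Z * n%:Z + bq a b.

Definition Rset (R : realType) (a : nat) (b : int) : set nat :=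
  [set n | Nabove (- (b%:~R / a%:R) : R) n /\
           (rad (rn a b n) %| gg a b)%N].

(* The number of elements, equal to +oo if the set is infinite. *)
Definition rho (R : realType) (a : nat) (b : int) : \bar R :=
  counting (Rset R a b).

Definition R'set (R : realType) (a : nat) (b : int) : set nat :=
  [set n | Nabove (- (b%:~R / a%:R) : R) n /\
           (2 <= tau (gg a b)%:Z (rn a b n))%N].

(* A prime is a positive integer, hence the positivity condition. *)
Definition Pset (a : nat) (b : int) : set nat :=
  [set n | (0 < n)%N /\ (0 < rn a b n /\ prime `|rn a b n|%N) /\
           ~ (rn a b n %| (gg a b)%:Z)%Z].

(* The argument of totient below is a * n + b, which is positive when n is
   greater than - b / a; the absolute value only casts it from int to nat.
   Where n > - d / c, the denominator c * n + d has the sign of c. Hence for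
   c < 0 clearing denominators reverses the inequality, and the set can be
   finite: Mset 1 0 (-1) 0 = [set 1]. *)
Definition Mset (R : realType) (a : nat) (b : int) (c d : R) : set nat :=
  [set n | [/\ (0 < n)%N,
     Num.max (- (b%:~R / a%:R)) (- (d / c)) < n%:R &
     (totient `|(a%:Z * n%:Z + b)%R|%N)%:R / (c * n%:R + d)
       <= (a%:R * (totient (gg a b))%:R) / (c * (gg a b)%:R)]].

(* Main.v *)
Require Import Defs.
From mathcomp Require Import fingroup cyclic separable algC cyclotomic classfun character.
From mathcomp Require Import sequences exp complex.
From mathcomp Require Import ring lra zify.

Set Implicit Arguments.
Unset Strict Implicit.
Unset Printing Implicit Defensive.

Import Order.TTheory GRing.Theory Num.Theory.
Import ComplexField.Normc.
Local Notation Re := complex.Re.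
Local Notation Im := complex.Im.
Local Open Scope complex_scope.
Local Open Scope ring_scope.

(** Write [an + b = g r_n]. Every prime of [gamma g r_n] divides [g] and no prime of
    [tau g r_n] does, so [totient (an + b)] is [totient g] times
    [gamma g r_n * totient (tau g r_n)]; call the last product the weight of [n]
    ([totient_gamma_tau]). Clearing denominators, [n] lies in [M] exactly when
    [weight / a' - d / c <= n] ([MsetP]), and since [r_n = a' n + b'] everything is
    decided by comparing the weight with [r_n]. It is at most [r_n], with equality on
    [R(a, b)]; it is at most [r_n - 1] on [R'(a, b)], with equality on [P(a, b)]. These
    four facts turn membership of a single element of [R(a, b)] or of [P(a, b)] in [M]
    into a lower bound for [d / c], and that bound back into the inclusion in [M] of a
    whole set; the criterion for [M] to be everything takes an element of [R(a, b)], or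
    one of [P(a, b)] when [R(a, b)] is empty. [M] is infinite because the weight is at
    most [(1 - 1 / s) r_n] whenever a prime [s] not dividing [a] divides [r_n].

    The substance is that [P(a, b)] is infinite, which is Dirichlet's theorem for the
    coprime pair [a'], [b'] ([dirichlet_primes]). Its proof uses only finite sums. For a
    Dirichlet character [chi] let [E(chi, N)] be the sum of
    [chi n * mangoldt n / n] over [n <= N]. For the principal character
    it is [ln N] up to a bounded error, by the estimates of Chebyshev and Mertens. For a
    nonprincipal [chi], [chi n / n] and [chi n * ln n / n] have bounded partial sums, the
    first with a limit [L] approached at rate [1 / N]. As [ln] is the divisor sum of
    [mangoldt], the second sum is [L * E(chi, N)] up to a bounded error, so [E(chi, N)]
    is bounded when [L <> 0] ([mangoldt_sum_bounded]). When [L = 0], Moebius inversion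
    shows instead that [E(chi, N)] is [- ln N] up to a bounded error
    ([mangoldt_sum_Lvalue0]).

    In fact [L] never vanishes ([dirichlet_Lvalue_neq0]). The sum of [E(chi, N)] over all
    characters is a nonnegative multiple of a sum of [mangoldt n / n], so at most one
    character can contribute [- ln N], and that character equals its conjugate. A real
    character is excluded by Monsky's argument ([real_char_Lvalue_neq0]): its divisor
    sums [A n] are nonnegative and at least 1 at squares, so the sum of [A n * t ^ n] is
    unbounded as [t] tends to 1; but it is the Lambert series of [chi], which [L = 0]
    would make bounded, by summation by parts against monotone weights.

    Consequently, in the combination of the [E(chi, N)] that selects a residue class, the
    principal character dominates, so the sum of [mangoldt n / n] over the class is
    unbounded. Proper prime powers contribute a bounded amount to it, so the class
    contains infinitely many primes. *)

(** * Sums over divisors *)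

Lemma sum_multiples (V : nmodType) (F : nat -> V) (N d : nat) : (0 < d)%N ->
  \sum_(1 <= n < N.+1 | (d %| n)%N) F (n %/ d)%N =
  \sum_(1 <= j < (N %/ d).+1) F j.
Proof.
move=> d0.
rewrite -big_filter (perm_big [seq (d * j)%N | j <- index_iota 1 (N %/ d).+1]).
  rewrite big_map; apply: eq_bigr => j _; by rewrite mulKn.
apply: uniq_perm.
- by rewrite filter_uniq ?iota_uniq.
- rewrite map_inj_uniq ?iota_uniq// => x y /eqP.
  by rewrite eqn_pmul2l// => /eqP.
move=> n; rewrite mem_filter mem_index_iota !ltnS; apply/idP/mapP.
- move=> /and3P[/dvdnP[j ->] j1 jN]; exists j; last by rewrite mulnC.
  rewrite mem_index_iota ltnS leq_divRL// jN andbT.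
  by move: j1; rewrite muln_gt0 => /andP[].
- move=> [j]; rewrite mem_index_iota ltnS => /andP[j1 jN] ->.
  by rewrite dvdn_mulr//= muln_gt0 d0 j1/= mulnC -leq_divRL.
Qed.

Lemma sum_divisorsE (V : nmodType) (F : nat -> V) (n N : nat) : (0 < n <= N)%N ->
  \sum_(d <- divisors n) F d = \sum_(1 <= d < N.+1 | (d %| n)%N) F d.
Proof.
move=> /andP[n0 nN]; rewrite -[RHS]big_filter; apply: perm_big.
apply: uniq_perm; rewrite ?divisors_uniq ?filter_uniq ?iota_uniq// => d.
rewrite mem_filter mem_index_iota -dvdn_divisors//.
case: (boolP (d %| n)%N) => //= dn.
by rewrite (dvdn_gt0 n0 dn) ltnS (leq_trans (dvdn_leq n0 dn)).
Qed.

(** Both sides run over the pairs [(d, j)] with [d * j <= N], grouped by their product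
    on the left and by [d] on the right. *)
Lemma sum_divisors_exchange (V : nmodType) (F : nat -> nat -> V) (N : nat) :
  \sum_(1 <= n < N.+1) \sum_(d <- divisors n) F d (n %/ d)%N =
  \sum_(1 <= d < N.+1) \sum_(1 <= j < (N %/ d).+1) F d j.
Proof.
transitivity (\sum_(1 <= n < N.+1) \sum_(1 <= d < N.+1 | (d %| n)%N) F d (n %/ d)%N).
  rewrite big_nat [RHS]big_nat; apply: eq_bigr => n /andP[n1 nN].
  by apply: sum_divisorsE; rewrite n1 -ltnS.
rewrite (exchange_big_dep_nat xpredT)//= big_nat [RHS]big_nat.
by apply: eq_bigr => d /andP[d0 _]; rewrite sum_multiples.
Qed.

(** The divisors of [p ^ v.+1 * m] that do not already divide [p ^ v * m] are those
    divisible by [p ^ v.+1]. This is the step of every induction on factorizations below. *)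
Lemma sum_divisors_pfactor (V : nmodType) (F : nat -> V) (p v m : nat) :
  prime p -> ~~ (p %| m)%N ->
  \sum_(d <- divisors (p ^ v.+1 * m)) F d =
  \sum_(d <- divisors (p ^ v * m)) F d + \sum_(e <- divisors m) F (p ^ v.+1 * e)%N.
Proof.
move=> pp pm.
have m0 : (0 < m)%N by move: pm; case: m => //; rewrite dvdn0.
have p0 := prime_gt0 pp.
have pv w : (0 < p ^ w)%N by rewrite expn_gt0 p0.
rewrite (perm_big (divisors (p ^ v * m) ++ [seq (p ^ v.+1 * e)%N | e <- divisors m])).
  by rewrite big_cat big_map.
have inj : injective (fun e => p ^ v.+1 * e)%N.
  by move=> x y /eqP; rewrite eqn_pmul2l// => /eqP.
apply: uniq_perm; rewrite ?divisors_uniq//.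
  rewrite cat_uniq divisors_uniq map_inj_uniq// divisors_uniq andbT.
  apply/hasPn => _ /mapP[e em ->]; apply/negP.
  rewrite -dvdn_divisors ?muln_gt0 ?pv// => /= h.
  have : (p ^ v.+1 %| p ^ v * m)%N := dvdn_trans (dvdn_mulr _ (dvdnn _)) h.
  by rewrite expnSr dvdn_pmul2l// (negbTE pm).
move=> d; rewrite mem_cat -!dvdn_divisors ?muln_gt0 ?pv//.
apply/idP/orP; last first.
  case=> [h|/mapP[e]].
    by apply: dvdn_trans h _; rewrite dvdn_pmul2r// dvdn_exp2l.
  by rewrite -dvdn_divisors// => em ->; rewrite dvdn_pmul2l.
move=> dn.
have d0 : (0 < d)%N by apply: dvdn_gt0 dn; rewrite muln_gt0 pv.
pose w := logn p d.
have [e pe de] : exists2 e, ~~ (p %| e)%N & d = (p ^ w * e)%N.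
  have [e ce de] := pfactor_coprime pp d0.
  by exists e; rewrite -?prime_coprime// mulnC.
have e0 : (0 < e)%N by move: pe; case: (e) => //; rewrite dvdn0.
have em : (e %| m)%N.
  have : (e %| p ^ v.+1 * m)%N by apply: dvdn_trans dn; rewrite de dvdn_mull.
  by rewrite Gauss_dvdr// coprime_sym coprimeXl// prime_coprime.
have wv : (w <= v.+1)%N.
  have := dvdn_leq_log p _ dn; rewrite muln_gt0 pv m0 => /(_ isT).
  rewrite lognM// lognX (logn_prime p pp) eqxx muln1 (@logn_coprime p m) ?prime_coprime//.
  by rewrite addn0.
move: wv; rewrite leq_eqVlt => /orP[/eqP wv|wv].
  right; apply/mapP; exists e; first by rewrite -dvdn_divisors.
  by rewrite -wv.
by left; rewrite de dvdn_mul// dvdn_exp2l.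
Qed.

Lemma pfactor_ind (P : nat -> Prop) : P 1%N ->
  (forall p v m, prime p -> ~~ (p %| m)%N -> P m -> P (p ^ v.+1 * m)%N) ->
  forall n, (0 < n)%N -> P n.
Proof.
move=> P1 PX; elim/ltn_ind => n IH n0.
have [n1|n1] := leqP n 1; first by have -> : n = 1%N by lia.
have pp := pdiv_prime n1; set p := pdiv n in pp.
have [m cm nE] := pfactor_coprime pp n0.
have v0 : (0 < logn p n)%N by rewrite logn_gt0 pi_pdiv.
have m0 : (0 < m)%N by move: n0; rewrite nE muln_gt0 => /andP[].
rewrite nE mulnC -(prednK v0); apply: PX; rewrite -?prime_coprime//.
apply: IH => //; rewrite [X in (_ < X)%N]nE ltn_Pmulr//.
by rewrite -(prednK v0) -{1}(exp1n (logn p n).-1.+1) ltn_exp2r ?prime_gt1.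
Qed.

Lemma primes_pfactorM (p v m : nat) : prime p -> (0 < m)%N ->
  primes (p ^ v.+1 * m) =i p :: primes m.
Proof.
move=> pp m0 q.
have pv : (0 < p ^ v.+1)%N by rewrite expn_gt0 prime_gt0.
by rewrite (primesM _ pv m0) primesX// primes_prime// !inE.
Qed.

(** * The von Mangoldt function *)

(** [n] is a power of a prime exactly when it has a single prime divisor. *)
Definition mangoldt (R : realType) (n : nat) : R :=
  if primes n is [:: p] then ln p%:R else 0.

Lemma mangoldt_ge0 (R : realType) (n : nat) : 0 <= mangoldt R n.
Proof.
rewrite /mangoldt; case E : (primes n) => [|p [|q s]]//.
have : p \in primes n by rewrite E inE.
by rewrite mem_primes => /andP[/prime_gt0 p0 _]; rewrite ln_ge0// ler1n.
Qed.

Lemma mangoldt_pfactor (R : realType) (p v : nat) : prime p ->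
  mangoldt R (p ^ v.+1) = ln p%:R.
Proof. by move=> pp; rewrite /mangoldt primesX// primes_prime. Qed.

Lemma mangoldt_neq0 (R : realType) (n : nat) : mangoldt R n != 0 ->
  exists p v, [/\ prime p, (0 < v)%N & n = (p ^ v)%N].
Proof.
rewrite /mangoldt; case E : (primes n) => [|p [|q s]]//; rewrite ?eqxx// => _.
have : p \in primes n by rewrite E inE.
rewrite -logn_gt0 => v0; exists p, (logn p n); split => //.
  by move: v0; rewrite logn_gt0 mem_primes => /andP[].
have n0 : (0 < n)%N by move: E; case: (n).
by rewrite [LHS](prod_prime_decomp n0) prime_decompE E big_map big_seq1.
Qed.

Lemma mangoldt_pfactorM_eq0 (R : realType) (p v m : nat) : prime p ->
  ~~ (p %| m)%N -> m != 1%N -> mangoldt R (p ^ v.+1 * m) = 0.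
Proof.
move=> pp pm m1.
have m0 : (0 < m)%N by move: pm; case: (m) => //; rewrite dvdn0.
have m2 : (1 < m)%N by rewrite ltn_neqAle eq_sym m1.
have h := primes_pfactorM v pp m0.
have hp : p \in primes (p ^ v.+1 * m) by rewrite h inE eqxx.
have hq : pdiv m \in primes (p ^ v.+1 * m).
  by rewrite h inE mem_primes pdiv_prime// m0 pdiv_dvd orbT.
rewrite /mangoldt; case E : (primes _) => [|r [|r' s]]//.
move: hp hq; rewrite E !inE => /eqP pr /eqP q.
by case/negP: pm; rewrite pr -q pdiv_dvd.
Qed.

Lemma divisors_1 : divisors 1 = [:: 1%N]. Proof. by []. Qed.

(** Passing from [p ^ v * m] to [p ^ v.+1 * m] adds the single prime power
    [p ^ v.+1] to the divisors at which [mangoldt] does not vanish. *)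
Lemma sum_divisors_mangoldt (R : realType) (n : nat) : (0 < n)%N ->
  \sum_(d <- divisors n) mangoldt R d = ln n%:R.
Proof.
elim/pfactor_ind => [|p v m pp pm IHm].
  by rewrite divisors_1 big_seq1 /mangoldt ln1.
have m0 : (0 < m)%N by move: pm; case: (m) => //; rewrite dvdn0.
have p0 := prime_gt0 pp.
have step w : \sum_(e <- divisors m) mangoldt R (p ^ w.+1 * e) = ln p%:R.
  rewrite (bigD1_seq 1%N) ?divisors_uniq//= -?dvdn_divisors// muln1.
  rewrite mangoldt_pfactor// big1_seq ?addr0// => e /andP[e1].
  rewrite -dvdn_divisors// => em; apply: mangoldt_pfactorM_eq0 => //.
  by apply: contra pm => pe; apply: dvdn_trans pe em.
elim: (v.+1) => [|w IHw]; first by rewrite expn0 mul1n.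
rewrite sum_divisors_pfactor// IHw step expnS -mulnA [in RHS]natrM.
by rewrite lnM ?posrE ?ltr0n ?muln_gt0 ?expn_gt0 ?p0// [RHS]addrC.
Qed.

(** * The Moebius function *)

(** The test says that [n] is squarefree. *)
Definition moebius (n : nat) : int :=
  if all (fun p => logn p n == 1)%N (primes n) then (-1) ^+ size (primes n) else 0.

Lemma normr_moebius_le1 (n : nat) : `|moebius n| <= 1.
Proof. by rewrite /moebius; case: ifP; rewrite ?normr0// normrX normrN1 expr1n. Qed.

Lemma moebius_primeM (p m : nat) : prime p -> ~~ (p %| m)%N ->
  moebius (p * m) = - moebius m.
Proof.
move=> pp pm.
have m0 : (0 < m)%N by move: pm; case: (m) => //; rewrite dvdn0.
have e : perm_eq (primes (p * m)) (p :: primes m).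
  apply: uniq_perm; rewrite /= ?primes_uniq ?andbT//.
    by rewrite mem_primes negb_and (negbTE pm) !andbF orbT.
  by move=> q; have := primes_pfactorM 0 pp m0 q; rewrite expn1.
have p0 := prime_gt0 pp.
rewrite /moebius (perm_all _ e) (perm_size e) /= exprS mulN1r.
have -> : logn p (p * m) == 1%N.
  by rewrite lognM// (logn_prime p pp) eqxx (@logn_coprime p m) ?prime_coprime.
have -> : all (fun q => logn q (p * m) == 1%N) (primes m) =
          all (fun q => logn q m == 1%N) (primes m).
  apply: eq_in_all => q; rewrite mem_primes => /and3P[pq _ qm].
  rewrite lognM// (logn_prime q pp).
  by have /negbTE -> : q != p by apply: contraNneq pm => <-.
by rewrite andTb; case: ifP; rewrite ?oppr0.
Qed.

Lemma moebius_eq0 (p m : nat) : prime p -> (0 < m)%N -> (p ^ 2 %| m)%N ->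
  moebius m = 0.
Proof.
move=> pp m0; rewrite pfactor_dvdn// => h.
rewrite /moebius ifF//; apply/negbTE/allPn; exists p.
  by rewrite -logn_gt0; apply: ltn_trans h.
by rewrite neq_ltn h orbT.
Qed.

(** If [p] divides [n], the squarefree divisors of [n] pair up as [d], [p * d] with [d]
    prime to [p], and [moebius] takes opposite values on each pair. *)
Lemma sum_divisors_moebius (n : nat) : (0 < n)%N ->
  \sum_(d <- divisors n) moebius d = (n == 1%N)%:R.
Proof.
elim/pfactor_ind => [|p v m pp pm _]; first by rewrite divisors_1 big_seq1.
have m0 : (0 < m)%N by move: pm; case: (m) => //; rewrite dvdn0.
have -> : (p ^ v.+1 * m == 1)%N = false.
  apply/negbTE; rewrite muln_eq1 negb_and; apply/orP; left.
  by rewrite expnS muln_eq1; case: (p) pp => [|[|]].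
elim: v => [|v IHv].
  rewrite sum_divisors_pfactor// expn0 mul1n -big_split big1_seq//= => d.
  rewrite -dvdn_divisors// expn1 => dm; rewrite moebius_primeM ?subrr//.
  by apply: contra pm => pd; apply: dvdn_trans pd dm.
rewrite sum_divisors_pfactor// IHv add0r big1_seq// => e.
rewrite -dvdn_divisors// => em; apply: (moebius_eq0 pp).
  by rewrite muln_gt0 expn_gt0 prime_gt0//= (dvdn_gt0 m0 em).
by apply: dvdn_mulr; apply: dvdn_exp2l.
Qed.

(** As [ln] is the divisor sum of [mangoldt] and the divisor sum of [moebius] is
    the unit of Dirichlet convolution, convolving [ln] with [moebius] gives
    [mangoldt] back. *)
Lemma sum_divisors_moebius_ln (R : realType) (n : nat) : (0 < n)%N ->
  \sum_(d <- divisors n) (moebius d)%:~R * ln (n %/ d)%:R = mangoldt R n.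
Proof.
move=> n0.
transitivity (\sum_(d <- divisors n) \sum_(e <- divisors (n %/ d))
   (moebius d)%:~R * mangoldt R e).
  apply: eq_big_seq => d; rewrite -dvdn_divisors// => dn.
  have q0 : (0 < n %/ d)%N by rewrite divn_gt0 ?(dvdn_gt0 n0 dn)// dvdn_leq.
  by rewrite -(sum_divisors_mangoldt R q0) mulr_sumr.
transitivity (\sum_(e <- divisors n) \sum_(d <- divisors (n %/ e))
   (moebius d)%:~R * mangoldt R e).
  (* both iterated sums run over the pairs (d, e) such that d * e divides n *)
  have E (F : nat -> nat -> R) : \sum_(d <- divisors n) \sum_(e <- divisors (n %/ d)) F d e =
     \sum_(1 <= d < n.+1) \sum_(1 <= e < n.+1) if (d * e %| n)%N then F d e else 0.
    rewrite (@sum_divisorsE _ _ n n) ?n0 ?leqnn// [LHS]big_mkcond big_nat [RHS]big_nat.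
    apply: eq_bigr => d /andP[d0 dn]; case: ifP => dvd; last first.
      rewrite big1// => e _; case: ifP => // h.
      by rewrite (dvdn_trans (dvdn_mulr _ (dvdnn d)) h) in dvd.
    have q0 : (0 < n %/ d <= n)%N.
      by rewrite leq_div andbT divn_gt0// (dvdn_leq n0 dvd).
    rewrite (sum_divisorsE _ q0).
    rewrite [LHS]big_mkcond; apply: eq_bigr => e _.
    by rewrite dvdn_divRL// mulnC.
  rewrite !E exchange_big; apply: eq_bigr => e _; apply: eq_bigr => d _.
  by rewrite mulnC.
rewrite (bigD1_seq n) ?divisors_uniq ?divisors_id//= divnn n0 divisors_1 big_seq1.
rewrite mul1r big1_seq ?addr0// => e /andP[en]; rewrite -dvdn_divisors// => dvd.
have q0 : (0 < n %/ e)%N by rewrite divn_gt0 ?(dvdn_gt0 n0 dvd)// (dvdn_leq n0 dvd).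
rewrite -mulr_suml -rmorph_sum sum_divisors_moebius//.
rewrite (_ : (_ == _) = false) ?mul0r//; apply: contraNF en => /eqP h.
by rewrite -(divnK dvd) h mul1n.
Qed.

(** * Chebyshev's estimate *)

Lemma ln_succ_sub_le (R : realType) (n : nat) : (0 < n)%N ->
  ln n.+1%:R - ln n%:R <= n%:R^-1 :> R.
Proof.
move=> n0; have nR : (0 : R) < n%:R by rewrite ltr0n.
rewrite -ln_div ?posrE ?ltr0n//.
have -> : n.+1%:R / n%:R = 1 + n%:R^-1 :> R.
  by rewrite -natr1 mulrDl divff ?gt_eqF// mul1r.
by apply: le_ln1Dx; have := invr_gt0 (n%:R : R); rewrite nR; lra.
Qed.

Lemma ln_nat_ge0 (R : realType) (n : nat) : 0 <= ln n%:R :> R.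
Proof. by case: n => [|n]; [rewrite ln0 | rewrite ln_ge0// ler1n]. Qed.

Lemma ln_fact_ge (R : realType) (N : nat) :
  N%:R * ln N%:R - N%:R <= ln (N`!)%:R :> R.
Proof.
elim: N => [|N IHN]; first by rewrite fact0 ln1 mul0r subr0.
rewrite factS natrM lnM ?posrE ?ltr0n ?fact_gt0// -[N.+1%:R in X in X <= _]natr1.
case: (posnP N) => [->|N0]; first by rewrite fact0 ln1 add0r mul1r ln1; lra.
have nR : (0 : R) < N%:R by rewrite ltr0n.
have := ler_wpM2l (ltW nR) (ln_succ_sub_le R N0); rewrite mulfV ?gt_eqF//.
by rewrite natr1; move: IHN; nra.
Qed.

Lemma ln_factE (R : realType) (N : nat) :
  ln (N`!)%:R = \sum_(1 <= n < N.+1) ln n%:R :> R.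
Proof.
elim: N => [|N IHN]; first by rewrite fact0 ln1 big_geq.
rewrite big_nat_recr//= -IHN factS mulnC natrM.
by rewrite lnM ?posrE ?ltr0n ?fact_gt0.
Qed.

Lemma ln_fact_le (R : realType) (N : nat) : ln (N`!)%:R <= N%:R * ln N%:R :> R.
Proof.
rewrite ln_factE -[X in X%:R * _](subn0 N) -subSS.
rewrite mulrC mulr_natr -sumr_const_nat.
rewrite big_nat [leRHS]big_nat; apply: ler_sum => n /andP[n0 nN].
by rewrite ler_ln ?posrE ?ltr0n// ?ler_nat//; apply: leq_trans n0 _.
Qed.

(** The factorial carries the estimates for [mangoldt]: [d] occurs once for each of its
    [N %/ d] multiples up to [N]. The upper end of the sum is free, as the terms beyond
    [N] vanish, so that factorials of different integers can be compared termwise. *)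
Lemma ln_fact_mangoldt (R : realType) (N M : nat) : (N <= M)%N ->
  ln (N`!)%:R = \sum_(1 <= d < M.+1) mangoldt R d * (N %/ d)%:R.
Proof.
move=> NM; transitivity (\sum_(1 <= d < N.+1) mangoldt R d * (N %/ d)%:R).
  rewrite ln_factE; transitivity
    (\sum_(1 <= n < N.+1) \sum_(d <- divisors n) mangoldt R d).
    rewrite big_nat [RHS]big_nat; apply: eq_bigr => n /andP[n0 _].
    by rewrite sum_divisors_mangoldt.
  rewrite (sum_divisors_exchange (fun d _ => mangoldt R d)).
  apply: eq_bigr => d _; rewrite sumr_const_nat subSS subn0.
  by rewrite mulr_natr.
rewrite [RHS](big_cat_nat (n := N.+1))//= [X in _ = _ + X]big1_seq ?addr0// => d.
by rewrite mem_index_iota => /andP[_ /andP[Nd _]]; rewrite divn_small// mulr0.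
Qed.

Lemma bin_le_exp2 (n m : nat) : ('C(n, m) <= 2 ^ n)%N.
Proof.
elim: n m => [|n IHn] [|m]; rewrite ?bin0 ?bin0n ?expn_gt0//.
by rewrite binS expnS mul2n -addnn leq_add.
Qed.

(** Each prime power [p ^ j] in the upper half of [1..N] accounts for one factor [p] of
    the binomial coefficient of [N] over [uphalf N], which is at most [2 ^ N]. *)
Lemma sum_mangoldt_half (R : realType) (N : nat) :
  \sum_(1 <= d < N.+1) mangoldt R d <=
  \sum_(1 <= d < (uphalf N).+1) mangoldt R d + N%:R.
Proof.
set h := uphalf N.
have hN : (h <= N)%N by rewrite /h uphalf_half; lia.
have hh : (N - h <= h)%N by rewrite /h uphalf_half; lia.
have lnC : ln 'C(N, h)%:R <= N%:R :> R.
  apply: (@le_trans _ _ (ln (2 ^ N)%:R)).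
    by rewrite ler_ln ?posrE ?ltr0n ?bin_gt0 ?expn_gt0// ler_nat bin_le_exp2.
  have ln2 : ln 2 <= 1 :> R by apply: (@le_ln1Dx R 1); lra.
  by rewrite natrX lnXn// -[leLHS]mulr_natl ler_piMr.
have lnCE : ln 'C(N, h)%:R = ln (N`!)%:R - ln (h`!)%:R - ln ((N - h)`!)%:R :> R.
  have := congr1 (fun n => ln (n%:R : R)) (bin_fact hN).
  rewrite natrM lnM ?posrE ?ltr0n ?bin_gt0 ?muln_gt0 ?fact_gt0//.
  rewrite natrM lnM ?posrE ?ltr0n ?fact_gt0//; lra.
rewrite (big_cat_nat (n := h.+1))//= lerD2l; apply: le_trans lnC.
rewrite lnCE (ln_fact_mangoldt R (leqnn N)) (ln_fact_mangoldt R hN).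
rewrite (ln_fact_mangoldt R (leq_subr h N)) -!sumrB [leRHS](big_cat_nat (n := h.+1))//=.
rewrite -[leLHS]add0r lerD//.
  apply: sumr_ge0 => d _; rewrite -!mulrBr mulr_ge0 ?mangoldt_ge0//.
  rewrite -addrA -opprD subr_ge0 -natrD ler_nat.
  rewrite -[X in (_ <= X %/ d)%N](subnKC hN).
  by have [->|d0] := posnP d; rewrite ?divn0// divnD// leq_addr.
rewrite big_nat [leRHS]big_nat; apply: ler_sum => d /andP[hd dN].
rewrite (divn_small hd) (divn_small (leq_ltn_trans hh hd)) !mulr0 !subr0.
by rewrite ler_peMr ?mangoldt_ge0// ler1n divn_gt0// (leq_ltn_trans _ hd).
Qed.

Lemma sum_mangoldt_le (R : realType) (N : nat) :
  \sum_(1 <= d < N.+1) mangoldt R d <= 4 * N%:R.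
Proof.
elim/ltn_ind: N => -[|[|N]] IHN; first by rewrite big_geq// mulr0.
  by rewrite big_nat1 mulr1 /mangoldt.
apply: le_trans (sum_mangoldt_half _ _) _.
have hN : (uphalf N.+2 < N.+2)%N by rewrite uphalf_half; lia.
apply: le_trans (lerD (IHN _ hN) (lexx _)) _.
have : (2 * uphalf N.+2 <= N.+3)%N by rewrite uphalf_half; lia.
move: (uphalf _) => h; have := ler0n R N.
by rewrite -(ler_nat R) natrM -!natr1; lra.
Qed.

(** * Mertens' estimate *)

Lemma sum_mangoldt_div_ge (R : realType) (N : nat) : (0 < N)%N ->
  ln N%:R - 1 <= \sum_(1 <= d < N.+1) mangoldt R d / d%:R.
Proof.
move=> N0; have NR : (0 : R) < N%:R by rewrite ltr0n.
rewrite -(ler_pM2l NR) mulrBr mulr1; apply: le_trans (ln_fact_ge R N) _.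
rewrite (ln_fact_mangoldt R (leqnn N)) mulr_sumr.
rewrite big_nat [leRHS]big_nat; apply: ler_sum => d /andP[d0 _].
rewrite mulrCA ler_wpM2l ?mangoldt_ge0// ler_pdivlMr ?ltr0n//.
by rewrite -natrM ler_nat leq_trunc_div.
Qed.

(** Replacing [N / d] by its floor changes the sum of [mangoldt d * N / d] by at most
    the sum of [mangoldt], which Chebyshev's bound makes linear in [N]. *)
Lemma sum_mangoldt_div_le (R : realType) (N : nat) : (0 < N)%N ->
  \sum_(1 <= d < N.+1) mangoldt R d / d%:R <= ln N%:R + 4.
Proof.
move=> N0; have NR : (0 : R) < N%:R by rewrite ltr0n.
rewrite -(ler_pM2l NR) mulrDr.
apply: le_trans (lerD (ln_fact_le R N) (le_refl _)); rewrite [_ * 4]mulrC.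
apply: le_trans (lerD (le_refl _) (sum_mangoldt_le R N)).
rewrite (ln_fact_mangoldt R (leqnn N)) mulr_sumr -big_split/=.
rewrite big_nat [leRHS]big_nat; apply: ler_sum => d /andP[d0 _].
rewrite mulrCA -{3}[mangoldt R d]mulr1 -mulrDr ler_wpM2l ?mangoldt_ge0//.
rewrite ler_pdivrMr ?ltr0n// natr1 -natrM ler_nat ltnW//.
exact: ltn_ceil.
Qed.

Lemma sum_ln_ratio_le (R : realType) (N : nat) :
  \sum_(1 <= d < N.+1) (ln N%:R - ln d%:R) <= N%:R :> R.
Proof.
rewrite sumrB -ln_factE sumr_const_nat subSS subn0 -[ln _ *+ N]mulr_natl.
by have := ln_fact_ge R N; lra.
Qed.

(** * Proper prime powers contribute a bounded amount *)

(** The terms are dominated by the successive differences of [(ln m + 2) / m]. *)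
Lemma sum_ln_div_sq_le (R : realType) (N : nat) :
  \sum_(2 <= m < N.+2) ln m%:R / (m%:R * (m%:R - 1)) <= 2 :> R.
Proof.
suff h : \sum_(2 <= m < N.+2) ln m%:R / (m%:R * (m%:R - 1)) <=
    2 - (ln N.+1%:R + 2) / N.+1%:R :> R.
  apply: le_trans h _; rewrite gerBl divr_ge0 ?addr_ge0 ?ln_nat_ge0//.
elim: N => [|N IHN]; first by rewrite big_geq// ln1 add0r divr1 subrr.
rewrite big_nat_recr//=; apply: le_trans (lerD IHN (le_refl _)) _.
set x : R := N.+1%:R; have x0 : 0 < x by rewrite ltr0n.
have x1 : 1 <= x by rewrite ler1n.
have xE : N.+2%:R = x + 1 :> R by rewrite natr1.
rewrite xE addrK.
have h := ln_succ_sub_le R (ltn0Sn N); rewrite xE -/x in h.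
have hx : x * x^-1 = 1 by rewrite divff// gt_eqF.
have h' : x * (ln (x + 1) - ln x) <= 1 by rewrite -[leRHS]hx ler_wpM2l// ltW.
have i1 : x^-1 <= 1 by rewrite invf_le1.
clearbody x; have nx : x != 0 by rewrite gt_eqF.
have nx1 : x + 1 != 0 by rewrite gt_eqF// addr_gt0.
rewrite -subr_ge0.
have -> : 2 - (ln (x + 1) + 2) / (x + 1) -
   (2 - (ln x + 2) / x + ln (x + 1) / ((x + 1) * x)) =
   (2 - (x + 1) * (ln (x + 1) - ln x)) / (x * (x + 1)).
  by field; rewrite nx nx1.
apply: divr_ge0; last by apply: mulr_ge0; lra.
rewrite subr_ge0 mulrDl mul1r; lra.
Qed.

Lemma sum_geometric_le (R : realType) (x : R) (J : nat) : 0 <= x < 1 ->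
  \sum_(2 <= j < J) x ^+ j <= x ^+ 2 / (1 - x).
Proof.
move=> /andP[x0 x1].
have x1' : 0 < 1 - x by rewrite subr_gt0.
have [J2|J2] := leqP J 2; first by rewrite big_geq// divr_ge0 ?exprn_ge0// ltW.
rewrite ler_pdivlMr//.
rewrite -[leRHS]subr0 -(subnKC (ltnW J2)); set K := (J - 2)%N.
suff -> : (\sum_(2 <= j < 2 + K) x ^+ j) * (1 - x) = x ^+ 2 - x ^+ (2 + K).
  by rewrite lerD2l lerN2 exprn_ge0.
elim: K => [|K IHK]; first by rewrite addn0 big_geq// mul0r subrr.
rewrite addnS big_nat_recr//= mulrDl IHK [x ^+ (2 + K).+1]exprS; ring.
Qed.

(** Charging each [p ^ j] with [2 <= j] to the pair [(p, j)] and summing the geometric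
    series over [j] leaves the convergent sum of [ln p / (p (p - 1))]. *)
Lemma sum_mangoldt_nonprime_le (R : realType) (N : nat) :
  \sum_(1 <= n < N.+1 | ~~ prime n) mangoldt R n / n%:R <= 2.
Proof.
pose F n p j : R := if n == (p ^ j)%N then ln p%:R / p%:R ^+ j else 0.
have F0 n p j : 0 <= F n p j.
  by rewrite /F; case: ifP => // _; rewrite divr_ge0 ?ln_nat_ge0// exprn_ge0.
apply: (@le_trans _ _
  (\sum_(1 <= n < N.+1) \sum_(2 <= p < N.+2) \sum_(2 <= j < N.+2) F n p j)).
  rewrite [leLHS]big_mkcond/= big_nat [leRHS]big_nat.
  apply: ler_sum => n /andP[n0 nN]; rewrite ltnS in nN.
  have S0 : 0 <= \sum_(2 <= p < N.+2) \sum_(2 <= j < N.+2) F n p j.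
    by apply: sumr_ge0 => p _; apply: sumr_ge0.
  case: ifP => // np; have [->|Ln0] := eqVneq (mangoldt R n) 0; first by rewrite mul0r.
  have [p [v [pp v0 nE]]] := mangoldt_neq0 Ln0.
  have v2 : (2 <= v)%N.
    case: v v0 nE => [//|[|//]] _ nE; move: np; rewrite nE expn1 pp//.
  have pn : (p <= n)%N by rewrite nE -{1}(expn1 p) leq_exp2l// prime_gt1.
  have vn : (v <= n)%N by rewrite nE ltnW// ltn_expl// prime_gt1.
  rewrite (bigD1_seq p) ?iota_uniq//=; last first.
    by rewrite mem_index_iota prime_gt1//= ltnS (leq_trans pn)// (leq_trans nN).
  rewrite (bigD1_seq v) ?iota_uniq//=; last first.
    by rewrite mem_index_iota v2//= ltnS (leq_trans vn)// (leq_trans nN).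
  rewrite -addrA ler_wpDr//.
    by apply: addr_ge0; apply: sumr_ge0 => // q _; apply: sumr_ge0.
  have -> : mangoldt R n = ln p%:R by rewrite nE -(prednK v0) mangoldt_pfactor.
  by rewrite /F -nE eqxx -natrX -nE.
rewrite exchange_big/=; apply: le_trans (sum_ln_div_sq_le R N).
rewrite big_nat [leRHS]big_nat; apply: ler_sum => p /andP[p2 _].
rewrite exchange_big/=.
have p0 : (0 : R) < p%:R by rewrite ltr0n ltnW.
have p1 : (1 : R) < p%:R by rewrite ltr1n.
apply: (@le_trans _ _ (\sum_(2 <= j < N.+2) ln p%:R * p%:R^-1 ^+ j)).
  apply: ler_sum => j _; rewrite exprVn.
  have Fne i : i != (p ^ j)%N -> F i p j = 0 by rewrite /F => /negbTE ->.
  have [h|h] := boolP (p ^ j \in index_iota 1 N.+1)%N.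
    rewrite (bigD1_seq (p ^ j)%N) ?iota_uniq//= /F eqxx.
    by rewrite big1 ?addr0// => i /Fne.
  rewrite big1_seq ?divr_ge0 ?ln_nat_ge0 ?exprn_ge0// => i /andP[_ iN].
  by apply: Fne; apply: contraNneq h => <-.
rewrite -mulr_sumr ler_wpM2l ?ln_nat_ge0//.
have := @sum_geometric_le R p%:R^-1 N.+2.
rewrite invr_ge0 ltW//= invf_lt1// p1 => /(_ isT) h; apply: le_trans h _.
rewrite le_eqVlt; apply/orP; left; apply/eqP; field.
by rewrite subr_eq0 !gt_eqF.
Qed.

(** * The norm of complex numbers *)

Lemma normc_sum (R : realType) (I : Type) (r : seq I) (P : pred I) (F : I -> R[i]) :
  normc (\sum_(i <- r | P i) F i) <= \sum_(i <- r | P i) normc (F i).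
Proof.
elim/big_rec2: _ => [|i y x _ h]; first by rewrite normc0.
by apply: le_trans (le_normcD _ _) _; rewrite lerD2l.
Qed.

Lemma normc_real (R : realType) (x : R) : normc x%:C = `|x|.
Proof. by rewrite /normc /= expr0n addr0 sqrtr_sqr. Qed.

Lemma normr_Re_le (R : realType) (z : R[i]) : `|Re z| <= normc z.
Proof.
case: z => x y /=; rewrite -sqrtr_sqr ler_sqrt ?addr_ge0 ?sqr_ge0//.
by rewrite lerDl sqr_ge0.
Qed.

Lemma normr_Im_le (R : realType) (z : R[i]) : `|Im z| <= normc z.
Proof.
case: z => x y /=; rewrite -sqrtr_sqr ler_sqrt ?addr_ge0 ?sqr_ge0//.
by rewrite lerDr sqr_ge0.
Qed.

Lemma normc_ge0 (R : realType) (z : R[i]) : 0 <= normc z.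
Proof. by case: z => x y; rewrite sqrtr_ge0. Qed.

Lemma normc_Re_Im (R : realType) (z : R[i]) : normc z <= `|Re z| + `|Im z|.
Proof.
have -> : z = (Re z)%:C + 'i%C * (Im z)%:C by rewrite -complexE.
apply: le_trans (le_normcD _ _) _; rewrite normcM !normc_real.
have -> : normc ('i%C : R[i]) = 1 by rewrite /normc expr0n expr1n add0r sqrtr1.
by rewrite mul1r -complexE.
Qed.

Lemma le_of_eq (R : realType) (x y : R) : x = y -> x <= y.
Proof. by move=> ->. Qed.

(** * Summation by parts and convergence *)

Lemma abel_summation_bound (R : realType) (a : nat -> R[i]) (f : nat -> R) (B : R)
    (m N : nat) :
  (forall N, normc (\sum_(m <= n < N) a n) <= B) ->
  (forall n, (m <= n)%N -> 0 <= f n.+1 <= f n) ->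
  normc (\sum_(m <= n < N) a n * (f n)%:C) <= B * f m.
Proof.
move=> aB f_dec.
have B0 : 0 <= B := le_trans (normc_ge0 _) (aB m).
have f0 n : (m <= n)%N -> 0 <= f n.
  by move=> /f_dec /andP[]; exact: le_trans.
have [Nm|mN] := leqP N m.
  by rewrite big_geq// normc0 mulr_ge0// f0.
rewrite -(subnKC (ltnW mN)); elim: (N - m)%N => {N mN}[|k IHk].
  by rewrite addn0 big_geq// normc0 mulr_ge0// f0.
(* once the boundary term is removed, the bound telescopes *)
suff h K : normc (\sum_(m <= n < m + K) a n * (f n)%:C -
      (\sum_(m <= n < m + K) a n) * (f (m + K)%N)%:C) <= B * (f m - f (m + K)%N).
  set K := k.+1; rewrite -[X in normc X](subrK
    ((\sum_(m <= n < m + K) a n) * (f (m + K)%N)%:C)).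
  apply: le_trans (le_normcD _ _) _; rewrite normcM normc_real.
  have fK := f0 _ (leq_addr K m); rewrite (ger0_norm fK).
  apply: le_trans (lerD (h K) (ler_wpM2r fK (aB _))) _.
  by rewrite mulrBr subrK.
elim: K => [|K IHK].
  by rewrite addn0 !big_geq// mul0r subrr normc0 subrr mulr0.
rewrite addnS !big_nat_recr ?leq_addr//=.
set S := \sum_(m <= n < m + K) _ * _ in IHK *.
set A := \sum_(m <= n < m + K) _ in IHK *.
have fK := f_dec _ (leq_addr K m).
have -> : S + a (m + K)%N * (f (m + K)%N)%:C - (A + a (m + K)%N) * (f (m + K).+1)%:C =
  (S - A * (f (m + K)%N)%:C) + (A + a (m + K)%N) * (f (m + K)%N - f (m + K).+1)%:C.
  by rewrite rmorphB /=; ring.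
apply: le_trans (le_normcD _ _) _; rewrite normcM normc_real.
have d0 : 0 <= f (m + K)%N - f (m + K).+1 by rewrite subr_ge0; case/andP: fK.
rewrite (ger0_norm d0).
have -> : A + a (m + K)%N = \sum_(m <= n < (m + K).+1) a n.
  by rewrite big_nat_recr ?leq_addr.
apply: le_trans (lerD IHK (ler_wpM2r d0 (aB _))) _.
by rewrite -mulrDr; apply: le_of_eq; congr (_ * _); ring.
Qed.

(** The limit is the supremum of the lower bounds [u m - e m], each of which lies below
    each upper bound [u n + e n]. *)
Lemma cauchy_rate (R : realType) (u e : nat -> R) :
  (forall m n, (m <= n)%N -> `|u n - u m| <= e m) ->
  exists l, forall m, `|l - u m| <= e m.
Proof.
move=> ue.
have e0 m : 0 <= e m := le_trans (normr_ge0 _) (ue m m (leqnn m)).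
pose E := [set x : R | exists m, x = u m - e m]%classic.
have ubE n : ubound E (u n + e n).
  move=> _ [m ->]; have [mn|/ltnW nm] := leqP m n.
    by have := ue _ _ mn; rewrite ler_norml => /andP[]; have := e0 n; lra.
  by have := ue _ _ nm; rewrite ler_norml => /andP[]; have := e0 m; lra.
exists (sup E) => m; rewrite ler_norml; apply/andP; split.
  rewrite lerBrDr addrC; apply: ub_le_sup; last by exists m.
  by exists (u 0%N + e 0%N); exact: ubE.
rewrite lerBlDl; apply: ge_sup; last exact: ubE.
by exists (u 0%N - e 0%N), 0%N.
Qed.

Lemma cauchy_rate_complex (R : realType) (u : nat -> R[i]) (e : nat -> R) :
  (forall m n, (m <= n)%N -> normc (u n - u m) <= e m) ->
  exists l, forall m, normc (l - u m) <= 2 * e m.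
Proof.
move=> ue.
have [x hx] : exists x, forall m, `|x - Re (u m)| <= e m.
  apply: (cauchy_rate (u := fun m => Re (u m))) => m n mn.
  apply: le_trans (ue _ _ mn); apply: le_trans (normr_Re_le _).
  by case: (u n) (u m) => [? ?] [? ?].
have [y hy] : exists y, forall m, `|y - Im (u m)| <= e m.
  apply: (cauchy_rate (u := fun m => Im (u m))) => m n mn.
  apply: le_trans (ue _ _ mn); apply: le_trans (normr_Im_le _).
  by case: (u n) (u m) => [? ?] [? ?].
exists (x +i* y) => m; apply: le_trans (normc_Re_Im _) _.
rewrite mulr_natl mulr2n lerD//; last by have := hy m; case: (u m).
by have := hx m; case: (u m).
Qed.

(** * Sums of a character against [1 / n] and [ln n / n] *)

(** What the analysis below uses of a nonprincipal Dirichlet character. *)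
Definition oscillating_character (R : realType) (chi : nat -> R[i]) : Prop :=
  [/\ chi 1%N = 1, {morph chi : m n / (m * n)%N >-> m * n},
      (forall n, normc (chi n) <= 1) &
      exists B, forall m N, normc (\sum_(m <= n < N) chi n) <= B].

Definition Lsum (R : realType) (chi : nat -> R[i]) (N : nat) : R[i] :=
  \sum_(1 <= n < N.+1) chi n * (n%:R^-1)%:C.

(** [L] is the value at 1 of the L-function of [chi]. The rate of convergence is included
    because [Lsum] is evaluated at all the quotients [N %/ d]. *)
Definition Lvalue (R : realType) (chi : nat -> R[i]) (L : R[i]) : Prop :=
  exists D, forall N, normc (Lsum chi N - L) <= D / N.+1%:R.

Lemma Lvalue_exists (R : realType) (chi : nat -> R[i]) :
  oscillating_character chi -> exists L, Lvalue chi L.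
Proof.
move=> [_ _ _ [B hB]].
have [L hL] : exists l, forall m, normc (l - Lsum chi m) <= 2 * (B * m.+1%:R^-1).
  apply: cauchy_rate_complex => m n mn.
  rewrite /Lsum (big_cat_nat (n := m.+1) (p := n.+1))//= addrAC subrr add0r.
  apply: (@abel_summation_bound _ _ (fun n => n%:R^-1)) => // k mk.
  by rewrite invr_ge0 ler0n/= lef_pV2 ?posrE ?ltr0n// ?ler_nat//; apply: leq_trans mk.
exists L, (2 * B) => N; rewrite -mulrA -normcN opprB; exact: hL.
Qed.

Lemma ln_div_nonincreasing (R : realType) (n : nat) : (4 <= n)%N ->
  ln n.+1%:R / n.+1%:R <= ln n%:R / n%:R :> R.
Proof.
move=> n4; have n0 : (0 < n)%N by apply: leq_trans n4.
have nR : (0 : R) < n%:R by rewrite ltr0n.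
(* ln 4 = 2 ln 2, and ln x >= 1 - 1 / x at x = 2 *)
have ln4 : (1 : R) <= ln n%:R.
  apply: (@le_trans _ _ (ln 4%:R)); last by rewrite ler_ln ?posrE ?ltr0n// ler_nat.
  have -> : 4%:R = (1 + - 2^-1)^-1 ^+ 2 :> R by field.
  rewrite lnXn; last by rewrite invr_gt0; lra.
  rewrite lnV ?posrE; last by lra.
  have : ln (1 + - 2^-1) <= - 2^-1 :> R by apply: le_ln1Dx; lra.
  by move: (ln _) => l; lra.
rewrite ler_pdivrMr ?ltr0n// mulrAC ler_pdivlMr//.
have := ler_wpM2l (ltW nR) (ln_succ_sub_le R n0); rewrite mulfV ?gt_eqF//.
by move: (ln n.+1%:R) => y; rewrite -natr1; lra.
Qed.

Lemma sum_char_ln_div_bounded (R : realType) (chi : nat -> R[i]) :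
  oscillating_character chi ->
  exists T, forall N,
    normc (\sum_(1 <= n < N.+1) chi n * (ln n%:R / n%:R)%:C) <= T.
Proof.
move=> [_ _ _ [B hB]].
have B0 : 0 <= B := le_trans (normc_ge0 _) (hB 0%N 0%N).
pose f n : R := ln n%:R / n%:R.
have f0 n : 0 <= f n by rewrite divr_ge0 ?ln_nat_ge0.
pose T0 := \sum_(1 <= n < 4) normc (chi n * (f n)%:C).
exists (T0 + B * f 4%N) => N.
have [N4|N4] := leqP N.+1 4.
  apply: le_trans (normc_sum _ _ _) _; apply: ler_wpDr; first by rewrite mulr_ge0.
  rewrite /T0 [leRHS](big_cat_nat (n := N.+1))//= lerDl.
  by apply: sumr_ge0 => n _; apply: normc_ge0.
rewrite (big_cat_nat (n := 4))//=; last exact: ltnW.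
apply: le_trans (le_normcD _ _) (lerD (normc_sum _ _ _) _).
apply: abel_summation_bound => // n n4.
by rewrite f0 ln_div_nonincreasing.
Qed.

(** Up to sign, the partial sums at 1 of the logarithmic derivative of the L-function. *)
Definition mangoldt_sum (R : realType) (chi : nat -> R[i]) (N : nat) : R[i] :=
  \sum_(1 <= n < N.+1) chi n * (mangoldt R n / n%:R)%:C.

Lemma Lvalue_quotient (R : realType) (chi : nat -> R[i]) (L : R[i]) (D : R) :
  (forall N, normc (Lsum chi N - L) <= D / N.+1%:R) ->
  forall N d, (0 < d)%N -> (0 < N)%N ->
  normc (Lsum chi (N %/ d) - L) <= D * d%:R / N%:R.
Proof.
move=> hD N d d0 N0; apply: le_trans (hD _) _.
have D0 : 0 <= D.
  by have := le_trans (normc_ge0 _) (hD 0%N); rewrite divr1.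
rewrite -mulrA ler_wpM2l// ler_pdivlMr ?ltr0n// mulrC ler_pdivrMr ?ltr0n//.
by rewrite -natrM ler_nat mulnC ltnW// ltn_ceil.
Qed.

(** Since [ln] is the divisor sum of [mangoldt], the bounded sum of
    [chi n * ln n / n] is, up to a bounded error, [L] times [mangoldt_sum]. *)
Lemma mangoldt_sum_bounded (R : realType) (chi : nat -> R[i]) (L : R[i]) :
  oscillating_character chi -> Lvalue chi L -> L != 0 ->
  exists K, forall N, normc (mangoldt_sum chi N) <= K.
Proof.
move=> chiP [D hD] L0; have [_ chiM chi_le _] := chiP.
have [T hT] := sum_char_ln_div_bounded chiP.
have nL0 : 0 < normc L.
  rewrite lt_neqAle normc_ge0 andbT eq_sym; apply: contra L0 => /eqP/eq0_normc ->.
  by rewrite eqxx.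
exists ((T + 4 * D) / normc L) => N.
have D0 : 0 <= D.
  by have := le_trans (normc_ge0 _) (hD 0%N); rewrite divr1.
rewrite ler_pdivlMr// -normcM.
case: (posnP N) => [->|N0].
  rewrite /mangoldt_sum big_geq// mul0r normc0 addr_ge0 ?mulr_ge0//.
  exact: le_trans (normc_ge0 _) (hT 0%N).
have NR : (0 : R) < N%:R by rewrite ltr0n.
have E : \sum_(1 <= n < N.+1) chi n * (ln n%:R / n%:R)%:C =
    \sum_(1 <= d < N.+1) chi d * (mangoldt R d / d%:R)%:C * Lsum chi (N %/ d).
  transitivity (\sum_(1 <= n < N.+1) \sum_(d <- divisors n)
     chi d * (mangoldt R d / d%:R)%:C * (chi (n %/ d)%N * ((n %/ d)%:R^-1)%:C)).
    rewrite big_nat [RHS]big_nat; apply: eq_bigr => n /andP[n0 _].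
    rewrite -(sum_divisors_mangoldt R n0) mulr_suml rmorph_sum mulr_sumr/=.
    apply: eq_big_seq => d; rewrite -dvdn_divisors// => dn.
    have d0 := dvdn_gt0 n0 dn.
    rewrite -{1 2}(divnK dn) chiM natrM invfM mulrA !rmorphM/=; ring.
  rewrite (sum_divisors_exchange (fun d j =>
     chi d * (mangoldt R d / d%:R)%:C * (chi j * (j%:R^-1)%:C))).
  by apply: eq_bigr => d _; rewrite -mulr_sumr.
have -> : mangoldt_sum chi N * L =
    \sum_(1 <= n < N.+1) chi n * (ln n%:R / n%:R)%:C +
    - \sum_(1 <= d < N.+1) chi d * (mangoldt R d / d%:R)%:C * (Lsum chi (N %/ d) - L).
  rewrite E -sumrB mulr_suml; apply: eq_bigr => d _; ring.
apply: le_trans (le_normcD _ _) (lerD (hT N) _); rewrite normcN.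
apply: le_trans (normc_sum _ _ _) _.
apply: (@le_trans _ _ (\sum_(1 <= d < N.+1) mangoldt R d * (D / N%:R))).
  rewrite big_nat [leRHS]big_nat; apply: ler_sum => d /andP[d0 _].
  have dR : (0 : R) < d%:R by rewrite ltr0n.
  rewrite !normcM normc_real ger0_norm ?divr_ge0 ?mangoldt_ge0//.
  apply: (@le_trans _ _ (1 * (mangoldt R d / d%:R) * (D * d%:R / N%:R))).
    have Ld0 : 0 <= mangoldt R d / d%:R by rewrite divr_ge0 ?mangoldt_ge0.
    apply: ler_pM; [by rewrite mulr_ge0 ?normc_ge0 | exact: normc_ge0 | | ].
      exact: ler_wpM2r.
    exact: Lvalue_quotient.
  by apply: le_of_eq; field; rewrite !gt_eqF.
rewrite -mulr_suml; apply: le_trans (ler_wpM2r _ (sum_mangoldt_le R N)) _.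
  by rewrite divr_ge0// ltW.
by apply: le_of_eq; field; rewrite gt_eqF.
Qed.

(** When [L] vanishes, weighting [chi n / n] by the convolution of [moebius] with
    [ln (N / d)], which is [ln N] at 1 plus [mangoldt], turns the smallness of the
    partial sums of [chi n / n] into an asymptotic formula. *)
Lemma mangoldt_sum_Lvalue0 (R : realType) (chi : nat -> R[i]) :
  oscillating_character chi -> Lvalue chi 0 ->
  exists D, forall N, (0 < N)%N ->
    normc (mangoldt_sum chi N + (ln N%:R)%:C) <= D.
Proof.
move=> [chi1 chiM chi_le _] [D hD]; exists D => N N0.
have D0 : 0 <= D.
  by have := le_trans (normc_ge0 _) (hD 0%N); rewrite divr1.
have NR : (0 : R) < N%:R by rewrite ltr0n.
have -> : mangoldt_sum chi N + (ln N%:R)%:C =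
    \sum_(1 <= d < N.+1)
      chi d * ((moebius d)%:~R / d%:R * (ln N%:R - ln d%:R))%:C * Lsum chi (N %/ d).
  transitivity (\sum_(1 <= n < N.+1) \sum_(d <- divisors n)
     chi d * ((moebius d)%:~R / d%:R * (ln N%:R - ln d%:R))%:C *
     (chi (n %/ d)%N * ((n %/ d)%:R^-1)%:C)); last first.
    rewrite (sum_divisors_exchange (fun d j =>
      chi d * ((moebius d)%:~R / d%:R * (ln N%:R - ln d%:R))%:C *
      (chi j * (j%:R^-1)%:C))).
    by apply: eq_bigr => d _; rewrite -mulr_sumr.
  transitivity (\sum_(1 <= n < N.+1) chi n *
     (((n == 1%N)%:R * (ln N%:R - ln n%:R) + mangoldt R n) / n%:R)%:C).
    rewrite /mangoldt_sum big_ltn// [RHS]big_ltn// chi1 eqxx ln1 subr0 !divr1 !mul1r.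
    rewrite addrAC -rmorphD/= [_ + ln _]addrC; congr (_ + _).
    rewrite big_nat [RHS]big_nat; apply: eq_bigr => n /andP[n2 _].
    by rewrite (gtn_eqF n2) mul0r add0r.
  rewrite big_nat [RHS]big_nat; apply: eq_bigr => n /andP[n0 _].
  rewrite -(sum_divisors_moebius_ln R n0).
  rewrite -[(n == _)%:R](rmorph_nat (intmul (1 : R))) -sum_divisors_moebius// rmorph_sum/=.
  rewrite mulr_suml -big_split mulr_suml/= rmorph_sum mulr_sumr/=.
  apply: eq_big_seq => d; rewrite -dvdn_divisors// => dn.
  have d0 := dvdn_gt0 n0 dn.
  have q0 : (0 < n %/ d)%N by rewrite divn_gt0// dvdn_leq.
  rewrite -{1 2 4}(divnK dn) chiM natrM invfM lnM ?posrE ?ltr0n//.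
  by rewrite !(rmorphM, rmorphD, rmorphB, rmorphN)/=; ring.
apply: le_trans (normc_sum _ _ _) _.
apply: (@le_trans _ _ (\sum_(1 <= d < N.+1) (ln N%:R - ln d%:R) * (D / N%:R))).
  rewrite big_nat [leRHS]big_nat; apply: ler_sum => d /andP[d0 dN].
  have dR : (0 : R) < d%:R by rewrite ltr0n.
  have l0 : 0 <= ln N%:R - ln d%:R :> R.
    by rewrite subr_ge0 ler_ln ?posrE// ler_nat -ltnS.
  rewrite !normcM normc_real !normrM (ger0_norm l0) normfV (ger0_norm (ltW dR)).
  apply: (@le_trans _ _ (1 * (1 / d%:R * (ln N%:R - ln d%:R)) * (D * d%:R / N%:R))).
    have d1 : 0 <= d%:R^-1 :> R by rewrite invr_ge0 ltW.
    apply: ler_pM; [by rewrite !mulr_ge0 ?normc_ge0 | exact: normc_ge0 | | ].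
      apply: ler_pM; rewrite ?mulr_ge0 ?normc_ge0// ler_wpM2r// ler_wpM2r//.
      by rewrite -intr_norm -[1]/(1%:~R) ler_int normr_moebius_le1.
    by have := Lvalue_quotient hD d0 N0; rewrite subr0.
  by apply: le_of_eq; field; rewrite !gt_eqF.
rewrite -mulr_suml; apply: le_trans (ler_wpM2r _ (sum_ln_ratio_le R N)) _.
  by rewrite divr_ge0// ltW.
by apply: le_of_eq; field; rewrite gt_eqF.
Qed.

(** * The divisor sums of a real character *)

Lemma bernoulli (R : realType) (x : R) (n : nat) : -1 <= x ->
  1 + n%:R * x <= (1 + x) ^+ n.
Proof.
move=> x1; elim: n => [|n IHn]; first by rewrite mul0r addr0.
have h : 0 <= 1 + x by lra.
rewrite exprS; apply: le_trans (ler_wpM2l h IHn).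
have : 0 <= n%:R * (x * x) by rewrite mulr_ge0 // -expr2 sqr_ge0.
by rewrite -natr1; lra.
Qed.

Definition char_divisor_sum (R : realType) (r : nat -> R) (n : nat) : R :=
  \sum_(d <- divisors n) r d.

Lemma sum_powers_sign (R : realType) (x : R) (v : nat) : x \in [:: 0; 1; -1] ->
  0 <= \sum_(i < v.+1) x ^+ i /\ (~~ odd v -> 1 <= \sum_(i < v.+1) x ^+ i).
Proof.
rewrite !inE => /or3P[] /eqP ->.
- rewrite big_ord_recl expr0 big1 ?addr0// => i _.
  by rewrite expr0n.
- under eq_bigr => i _ do rewrite expr1n.
  by rewrite sumr_const card_ord ler0n ler1n.
suff -> : \sum_(i < v.+1) (-1) ^+ i = (~~ odd v)%:R :> R.
  by split=> [|->] //; rewrite ler0n.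
elim: v => [|v IHv]; first by rewrite big_ord1.
rewrite big_ord_recr/= IHv -signr_odd/=.
by case: (odd v); rewrite ?expr1 ?expr0 ?addrN ?add0r ?subrr.
Qed.

(** By multiplicativity the divisor sum is a product over the primes [p] of [n] of the
    sums of [r p ^ i] for [i] up to the exponent [v] of [p], which are nonnegative, and
    at least 1 when [v] is even. Squares are described by the parity of their exponents,
    a condition that passes to the cofactor of a prime power. *)
Lemma char_divisor_sum_sign (R : realType) (r : nat -> R) (n : nat) :
  r 1%N = 1 -> {morph r : m n / (m * n)%N >-> m * n} ->
  (forall n, r n \in [:: 0; 1; -1]) -> (0 < n)%N ->
  0 <= char_divisor_sum r n /\
  ((forall q, ~~ odd (logn q n)) -> 1 <= char_divisor_sum r n).
Proof.
move=> r1 rM r01 n0; move: n n0; apply: pfactor_ind => [|p v m pp pm [IH0 IH1]].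
  by rewrite /char_divisor_sum divisors_1 big_seq1 r1 ler01 lexx.
have m0 : (0 < m)%N by move: pm; case: (m) => //; rewrite dvdn0.
have p0 := prime_gt0 pp.
have E w : char_divisor_sum r (p ^ w * m) =
    (\sum_(i < w.+1) r p ^+ i) * char_divisor_sum r m.
  elim: w => [|w IHw]; first by rewrite mul1n big_ord1 mul1r.
  rewrite {1}/char_divisor_sum sum_divisors_pfactor// -/(char_divisor_sum _ _) IHw.
  rewrite [in RHS]big_ord_recr/= [RHS]mulrDl [X in _ = _ + X]mulr_sumr; congr (_ + _).
  apply: eq_bigr => e _; rewrite rM; congr (_ * _).
  by elim: (w.+1) => [|u IHu]; rewrite ?r1// expnS rM IHu exprS.
have [h0 h1] := sum_powers_sign v.+1 (r01 p).
rewrite E; split; first exact: mulr_ge0.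
move=> lodd.
have hv : ~~ odd v.+1.
  have := lodd p; rewrite lognM ?expn_gt0 ?p0// lognX (logn_prime p pp) eqxx muln1.
  by rewrite (@logn_coprime p m) ?prime_coprime// addn0.
have hm q : ~~ odd (logn q m).
  have [->|qp] := eqVneq q p; first by rewrite logn_coprime// prime_coprime.
  have := lodd q; rewrite lognM ?expn_gt0 ?p0// lognX (logn_prime q pp).
  by rewrite (negbTE qp) muln0.
by rewrite -[1]mulr1 ler_pM// ?h1// IH1.
Qed.

(** * Lambert series *)

(** Going from [m] to [m + 1], the new first and last terms [1] and [t ^ (2 m + 1)] add
    at least [2 t ^ (m + 1)], by the square of [1 - t ^ (m + 1)]. *)
Lemma geometric_double_ge (R : realType) (t : R) (m : nat) : 0 <= t <= 1 ->
  (m.*2)%:R * t ^+ m <= \sum_(i < m.*2) t ^+ i.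
Proof.
move=> /andP[t0 t1]; elim: m => [|m IHm]; first by rewrite big_ord0 mul0r.
rewrite doubleS big_ord_recr big_ord_recl/= expr0.
under eq_bigr => i _ do rewrite /bump/= add1n exprS.
rewrite -mulr_sumr.
have h1 := ler_wpM2l t0 IHm.
have sq : 0 <= (1 - t ^+ m.+1) ^+ 2 by rewrite sqr_ge0.
have tm : t ^+ m.+1 * t ^+ m.+1 <= t ^+ (m.*2).+1.
  by rewrite -exprD addSn addnS addnn exprS ler_piMl ?exprn_ge0.
rewrite -[(m.*2).+2]addn2 natrD.
move: h1 sq tm; rewrite expr2 [t ^+ m.+1]exprS.
move: (t ^+ m) (\sum_(i < m.*2) _) (t ^+ _) => y S z; lra.
Qed.

(** Let [G n] be the sum of [t ^ i] for [i < n]. The identity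
    [G (n + 2) = t * G n + 1 + t ^ (n + 1)] reduces the induction step to the
    bound of [geometric_double_ge] on [G (2 n + 2) = G (n + 1) * (1 + t ^ (n + 1))]. *)
Lemma geometric_prod_ge (R : realType) (t : R) (n : nat) : 0 <= t <= 1 ->
  n%:R * n.+1%:R * t ^+ n <= (\sum_(i < n) t ^+ i) * (\sum_(i < n.+1) t ^+ i).
Proof.
move=> t01; have /andP[t0 t1] := t01.
elim: n => [|n IHn]; first by rewrite !mul0r big_ord0 mul0r.
have := geometric_double_ge n.+1 t01; rewrite -addnn big_split_ord/=.
under [X in _ <= _ + X]eq_bigr => i _ do rewrite exprD.
rewrite -mulr_sumr natrD.
have -> : \sum_(i < n.+2) t ^+ i = t * (\sum_(i < n) t ^+ i) + 1 + t ^+ n.+1.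
  rewrite big_ord_recr big_ord_recl/= expr0 addrC [1 + _]addrC addrC.
  congr (_ + _ + _); rewrite mulr_sumr; apply: eq_bigr => i _.
  by rewrite /bump/= add1n exprS.
have := ler_wpM2l t0 IHn; rewrite -[n.+2]addn2 natrD [t ^+ n.+1]exprS -natr1.
move: (\sum_(i < n.+1) _) (\sum_(i < n) _) (t ^+ n) => S' S y.
lra.
Qed.

(** The coefficient [t ^ n / (1 - t ^ n)] of a Lambert series, subtracted from its
    leading part as [t] tends to 1. *)
Definition lambert_weight (R : realType) (t : R) (n : nat) : R :=
  (n%:R * (1 - t))^-1 - t ^+ n / (1 - t ^+ n).

Lemma lambert_weightE (R : realType) (t : R) (n : nat) : 0 < t < 1 -> (0 < n)%N ->
  lambert_weight t n = (1 - t)^-1 * (n%:R^-1 - t ^+ n / \sum_(i < n) t ^+ i).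
Proof.
move=> /andP[t0 t1] n0; rewrite /lambert_weight.
have -> : 1 - t ^+ n = (1 - t) * \sum_(i < n) t ^+ i.
  by rewrite -[LHS]opprB subrX1 -mulNr opprB.
by rewrite !invfM; ring.
Qed.

(** With [G n] the sum of [t ^ i] for [i < n], the difference of consecutive weights is
    [1 / (n (n + 1)) - t ^ n / (G n * G (n + 1))] up to the factor [1 / (1 - t)], because
    [G (n + 1) - t * G n = 1]; it is nonnegative by [geometric_prod_ge]. *)
Lemma lambert_weight_mono (R : realType) (t : R) (n : nat) : 0 < t < 1 -> (0 < n)%N ->
  0 <= lambert_weight t n.+1 <= lambert_weight t n.
Proof.
move=> t01 n0; have /andP[t0 t1] := t01.
have t01' : 0 <= t <= 1 by rewrite !ltW.
have geo_gt0 m : (0 < m)%N -> 0 < \sum_(i < m) t ^+ i.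
  case: m => // m _; rewrite big_ord_recl expr0 ltr_pwDl//.
  by apply: sumr_ge0 => i _; rewrite exprn_ge0// ltW.
have i0 : 0 <= (1 - t)^-1 by rewrite invr_ge0 subr_ge0 ltW.
rewrite !lambert_weightE//; apply/andP; split.
  apply: mulr_ge0 => //; rewrite subr_ge0 ler_pdivrMr ?geo_gt0//.
  rewrite ler_pdivlMl ?ltr0n// mulr_natl.
  have -> : t ^+ n.+1 *+ n.+1 = \sum_(i < n.+1) t ^+ n.+1 by rewrite sumr_const card_ord.
  by apply: ler_sum => i _; rewrite ler_wiXn2l ?(ltW t0) ?(ltW t1)// ltnW.
rewrite ler_wpM2l//; have := geometric_prod_ge n t01'.
have G1 : \sum_(i < n.+1) t ^+ i = 1 + t * \sum_(i < n) t ^+ i.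
  rewrite big_ord_recl expr0 mulr_sumr; congr (_ + _); apply: eq_bigr => i _.
  by rewrite -exprS.
have G0 := geo_gt0 _ n0; have G0' := geo_gt0 _ (ltn0Sn n).
have N0 : (0 : R) < n%:R by rewrite ltr0n.
have N0' : (0 : R) < n.+1%:R by rewrite ltr0n.
have N1 : n.+1%:R = n%:R + 1 :> R by rewrite natr1.
move: G1 G0 G0' N0 N0' N1; rewrite exprS.
move: (\sum_(i < n.+1) _) (\sum_(i < n) _) (t ^+ n) (n.+1%:R) (n%:R) => G' G y k' k.
move=> G1 G0 G0' N0 N0' N1 h; rewrite -subr_ge0.
have -> : k^-1 - y / G - (k'^-1 - t * y / G') =
    (G * G' * (k' - k) - k * k' * y * (G' - t * G)) / (k * k' * (G * G')).
  by field; rewrite !gt_eqF.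
apply: divr_ge0; last by rewrite !mulr_ge0 ?ltW.
rewrite N1 in h *; rewrite G1 in h *; rewrite subr_ge0; lra.
Qed.

(** Monsky's bound. The hypothesis with [D] is the vanishing of the L-function at 1: it
    makes the leading parts [r n / (n (1 - t))] of the Lambert series sum to a small
    term. What remains is a sum against the monotone [lambert_weight], bounded by [B]
    uniformly in [t]; the last error term comes from cutting the geometric series at
    products [d * j <= N]. *)
Lemma sum_char_divisor_sum_le (R : realType) (r : nat -> R) (B D t : R) (N : nat) :
  (forall n, `|r n| <= 1) ->
  (forall m N, `|\sum_(m <= n < N) r n| <= B) ->
  (forall N, `|\sum_(1 <= n < N.+1) r n / n%:R| <= D / N.+1%:R) ->
  0 < t < 1 ->
  \sum_(1 <= n < N.+1) char_divisor_sum r n * t ^+ n <=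
    B + (D / N.+1%:R + N%:R * t ^+ N) / (1 - t).
Proof.
move=> r_le hB hD t01; have /andP[t0 t1] := t01.
have u0 : 0 < 1 - t by rewrite subr_gt0.
have tn0 n : 0 <= t ^+ n by rewrite exprn_ge0// ltW.
have tn1 n : (0 < n)%N -> 1 - t <= 1 - t ^+ n.
  by move=> n0; rewrite lerD2l lerN2 -{2}(expr1 t) ler_wiXn2l ?ltW.
have utn0 n : (0 < n)%N -> 0 < 1 - t ^+ n by move=> /tn1; exact: lt_le_trans.
have -> : \sum_(1 <= n < N.+1) char_divisor_sum r n * t ^+ n =
    - \sum_(1 <= n < N.+1) r n * lambert_weight t n +
    ((\sum_(1 <= n < N.+1) r n / n%:R) / (1 - t) -
    \sum_(1 <= d < N.+1) r d * (t ^+ (d * (N %/ d).+1) / (1 - t ^+ d))).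
  transitivity (\sum_(1 <= n < N.+1) \sum_(d <- divisors n) r d * t ^+ (d * (n %/ d))).
    rewrite big_nat [RHS]big_nat; apply: eq_bigr => n /andP[n0 _].
    rewrite /char_divisor_sum mulr_suml; apply: eq_big_seq => d.
    by rewrite -dvdn_divisors// mulnC => /divnK ->.
  rewrite (sum_divisors_exchange (fun d j => r d * t ^+ (d * j))).
  rewrite mulr_suml -sumrB -sumrN -big_split/=.
  rewrite big_nat [RHS]big_nat; apply: eq_bigr => d /andP[d0 _].
  have -> : \sum_(1 <= j < (N %/ d).+1) r d * t ^+ (d * j) =
      r d * ((t ^+ d - t ^+ (d * (N %/ d).+1)) / (1 - t ^+ d)).
    rewrite -mulr_sumr; congr (_ * _); apply: (mulIf (lt0r_neq0 (utn0 _ d0))).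
    rewrite divfK ?lt0r_neq0 ?utn0//; elim: (N %/ d)%N => [|k IHk].
      by rewrite big_geq// mul0r muln1 subrr.
    rewrite big_nat_recr//= mulrDl IHk [(d * k.+2)%N]mulnS exprD; ring.
  rewrite /lambert_weight; field.
  by rewrite !lt0r_neq0 ?utn0// ltr0n.
have bound1 : - \sum_(1 <= n < N.+1) r n * lambert_weight t n <= B.
  apply: le_trans (ler_norm _) _; rewrite normrN -normc_real rmorph_sum/=.
  under eq_bigr => n _ do rewrite rmorphM/=.
  have w1 : lambert_weight t 1 = 1.
    rewrite /lambert_weight expr1 mul1r; field; exact: lt0r_neq0.
  rewrite -[B]mulr1 -w1; apply: abel_summation_bound => [m|n n0].
    by rewrite -rmorph_sum normc_real.
  exact: lambert_weight_mono.
apply: le_trans (lerD bound1 (le_refl _)) _; rewrite lerD2l mulrDl.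
apply: lerD.
  by rewrite ler_wpM2r ?invr_ge0 ?(ltW u0)//; apply: le_trans (ler_norm _) (hD N).
apply: le_trans (ler_norm _) _; rewrite normrN; apply: le_trans (ler_norm_sum _ _ _) _.
have -> : N%:R * t ^+ N / (1 - t) = \sum_(1 <= d < N.+1) t ^+ N / (1 - t).
  by rewrite sumr_const_nat subSS subn0 -mulrA mulr_natl.
rewrite big_nat [leRHS]big_nat; apply: ler_sum => d /andP[d0 _].
rewrite normrM -[leRHS]mul1r ler_pM// ger0_norm ?divr_ge0 ?(ltW (utn0 _ d0))//.
rewrite ler_pM ?invr_ge0 ?(ltW (utn0 _ d0))//.
  by rewrite ler_wiXn2l ?(ltW t0) ?(ltW t1)// mulnC ltnW// ltn_ceil.
by rewrite lef_pV2 ?posrE ?utn0// tn1.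
Qed.

Lemma sum_char_divisor_sum_ge (R : realType) (r : nat -> R) (t : R) (K N : nat) :
  r 1%N = 1 -> {morph r : m n / (m * n)%N >-> m * n} ->
  (forall n, r n \in [:: 0; 1; -1]) -> 0 <= t <= 1 -> (K ^ 2 <= N)%N ->
  K%:R * t ^+ (K ^ 2) <= \sum_(1 <= n < N.+1) char_divisor_sum r n * t ^+ n.
Proof.
move=> r1 rM r01 /andP[t0 t1] KN.
have tn0 n : 0 <= t ^+ n by rewrite exprn_ge0.
have A0 n : 0 <= char_divisor_sum r n * t ^+ n.
  rewrite mulr_ge0//; case: (posnP n) => [->|n0].
    by rewrite /char_divisor_sum big_seq1 r1.
  by have [] := char_divisor_sum_sign r1 rM r01 n0.
have A0s P i j : 0 <= \sum_(i <= n < j | P n) char_divisor_sum r n * t ^+ n.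
  by apply: sumr_ge0.
rewrite (big_cat_nat (n := (K ^ 2).+1))//= ler_wpDr//.
suff h k : (k <= K)%N -> k%:R * t ^+ (K ^ 2) <=
    \sum_(1 <= n < (k ^ 2).+1) char_divisor_sum r n * t ^+ n by exact: h.
elim: k => [|k IHk] kK; first by rewrite mul0r big_geq.
have kk : (k ^ 2 < k.+1 ^ 2)%N by rewrite ltn_exp2r.
rewrite (big_cat_nat (n := (k ^ 2).+1))//=; last exact: ltnW.
rewrite -natr1 mulrDl mul1r lerD// ?IHk ?(ltnW kK)//.
rewrite big_nat_recr//= -[leLHS]add0r lerD//.
have k20 : (0 < k.+1 ^ 2)%N by rewrite expn_gt0.
have [_ h] := char_divisor_sum_sign r1 rM r01 k20.
have {}h : 1 <= char_divisor_sum r (k.+1 ^ 2).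
  by apply: h => q; rewrite lognX mul2n odd_double.
rewrite -[leLHS]mul1r ler_pM// ler_wiXn2l// leq_exp2r//.
Qed.

(** With [x = 1 / t - 1], Bernoulli's inequality gives [t ^ (2 J) <= (J x) ^ -2], so
    [N * t ^ N] tends to 0. *)
Lemma exists_mul_exp_small (R : realType) (t C e : R) (N0 : nat) :
  0 < t < 1 -> 0 < e ->
  exists2 N, (N0 <= N)%N & C / N.+1%:R + N%:R * t ^+ N <= e.
Proof.
move=> /andP[t0 t1] e0.
pose x := t^-1 - 1.
have x0 : 0 < x by rewrite subr_gt0 invf_gt1.
pose c := 8 / x ^+ 2 / e + 2 * `|C| / e + N0%:R.
have h1 : 0 <= 8 / x ^+ 2 / e by rewrite !divr_ge0 ?sqr_ge0// ltW.
have h2 : 0 <= 2 * `|C| / e by rewrite divr_ge0 ?mulr_ge0// ltW.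
have h3 : 0 <= N0%:R :> R by [].
have c0 : 0 <= c by rewrite !addr_ge0.
pose J := (Num.bound c).+1.
have cJ : c <= J%:R.
  by apply: le_trans (ltW (archi_boundP c0)) _; rewrite ler_nat.
have J0 : (0 : R) < J%:R by rewrite ltr0n.
have CJ : 2 * `|C| <= J%:R * e.
  by rewrite -ler_pdivrMr//; move: cJ; rewrite /c; lra.
have xJe : 8 <= J%:R * e * x ^+ 2.
  by rewrite -!ler_pdivrMr ?exprn_gt0//; move: cJ; rewrite /c; lra.
exists J.*2.
  by rewrite -(ler_nat R) -addnn natrD; move: cJ; rewrite /c; lra.
have xJ : (1 + x) ^+ J.*2 >= (J%:R * x) ^+ 2.
  rewrite -muln2 exprM lerXn2r ?nnegrE//; first by rewrite mulr_ge0// ltW.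
    by rewrite exprn_ge0// addr_ge0// ltW.
  have x1 : -1 <= x by lra.
  by have := @bernoulli R x J x1; lra.
have tE : t ^+ J.*2 <= ((J%:R * x) ^+ 2)^-1.
  have -> : t ^+ J.*2 = ((1 + x) ^+ J.*2)^-1.
    by rewrite /x addrC subrK exprVn invrK.
  by rewrite lef_pV2// posrE exprn_gt0// ?mulr_gt0// addr_gt0.
have -> : e = e / 2 + e / 2 by field.
apply: lerD.
  rewrite ler_pdivrMr ?ltr0n// -[J.*2.+1%:R]natr1 -addnn natrD.
  by have := ler_norm C; have := normr_ge0 C; lra.
apply: le_trans (ler_wpM2l _ tE) _ => //.
rewrite -addnn natrD ler_pdivrMr ?exprn_gt0 ?mulr_gt0//.
have -> : (J%:R * x) ^+ 2 = J%:R * (J%:R * x ^+ 2) by ring.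
by move: xJe => /(ler_wpM2l (ltW J0)); lra.
Qed.

(** The divisor sums of a real character are nonnegative, and at least 1 at squares:
    near [t = 1] they would make the bounded sum of [sum_char_divisor_sum_le]
    arbitrarily large. *)
Lemma real_char_Lvalue_neq0 (R : realType) (r : nat -> R) :
  (forall n, r n \in [:: 0; 1; -1]) ->
  oscillating_character (fun n => (r n)%:C) -> ~ Lvalue (fun n => (r n)%:C) 0.
Proof.
move=> r01 [/complexI r1 rM r_le [B hB]] [D hD].
have {}rM : {morph r : m n / (m * n)%N >-> m * n}.
  by move=> m n; apply: complexI; rewrite rM rmorphM.
have {}r_le n : `|r n| <= 1 by rewrite -normc_real.
have {}hB m N : `|\sum_(m <= n < N) r n| <= B.
  by rewrite -normc_real rmorph_sum.
have {}hD N : `|\sum_(1 <= n < N.+1) r n / n%:R| <= D / N.+1%:R.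
  rewrite -normc_real rmorph_sum/=; have := hD N; rewrite subr0 /Lsum.
  by under [X in _ -> normc X <= _]eq_bigr => n _ do rewrite rmorphM/=.
have B0 : 0 <= B := le_trans (normr_ge0 _) (hB 0%N 0%N).
have h0 : 0 <= 2 * B + 4 by lra.
pose K := Num.bound (2 * B + 4).
have hK : 2 * B + 4 < K%:R := archi_boundP h0.
have K0 : (0 < K)%N by rewrite -(ltr_nat R); lra.
have M0 : (0 : R) < (K ^ 2)%:R by rewrite ltr0n expn_gt0 K0.
have M1 : (1 : R) <= (K ^ 2)%:R by rewrite ler1n expn_gt0 K0.
(* at t = 1 - u, Bernoulli's inequality keeps t ^ (K ^ 2) above 1 / 2 *)
pose u : R := (2 * (K ^ 2)%:R)^-1.
have u0 : 0 < u by rewrite invr_gt0; lra.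
have u1 : u < 1 by rewrite invf_lt1; lra.
have Mu : (K ^ 2)%:R * u = 2^-1 by rewrite /u; field; rewrite gt_eqF.
pose t := 1 - u.
have t01 : 0 < t < 1 by rewrite /t; apply/andP; split; lra.
have t01' : 0 <= t <= 1 by rewrite /t; apply/andP; split; lra.
have tK : 2^-1 <= t ^+ (K ^ 2).
  have : -1 <= - u by lra.
  by move=> /(@bernoulli R _ (K ^ 2)); rewrite mulrN Mu /t; lra.
have [N KN hN] := exists_mul_exp_small D (K ^ 2) t01 u0.
have := le_trans (sum_char_divisor_sum_ge r1 rM r01 t01' KN)
  (sum_char_divisor_sum_le N r_le hB hD t01).
have -> : 1 - t = u by rewrite /t; ring.
have : (D / N.+1%:R + N%:R * t ^+ N) / u <= 1 by rewrite ler_pdivrMr// mul1r.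
have := ler_wpM2l (ler0n R K) tK.
move=> h1 h2 h3; have h4 := le_trans h1 (le_trans h3 (lerD (le_refl B) h2)).
by move: hK h4; move: (K%:R) => k; lra.
Qed.

(** * Characters of a finite abelian group *)

Lemma prim_root_exists (C : numClosedFieldType) (n : nat) : (0 < n)%N ->
  exists z : C, n.-primitive_root z.
Proof.
move=> n0; pose p : {poly C} := 'X^n - 1.
have [r Dp] := closed_field_poly_normal p.
rewrite (monicP _) ?monicXnsubC// scale1r in Dp.
have rn1 : all n.-unity_root r by apply/allP => z; rewrite -root_prod_XsubC -Dp.
have sz_r : (n < (size r).+1)%N.
  by rewrite -(size_prod_XsubC r id) -Dp size_XnsubC.
have uniq_r : uniq r.
  by rewrite -separable_prod_XsubC -Dp separable_Xn_sub_1// pnatr_eq0 -lt0n.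
by have /hasP[z _ zP] := has_prim_root n0 rn1 uniq_r sz_r; exists z.
Qed.

Definition is_group_character (C : pzRingType) (gT : finGroupType) (phi : gT -> C) :=
  phi 1%g = 1 /\ {morph phi : x y / (x * y)%g >-> x * y}.

Lemma group_character_card (C : pzRingType) (gT : finGroupType) (phi : gT -> C) (x : gT) :
  is_group_character phi -> phi x ^+ #|gT| = 1.
Proof.
move=> [phi1 phiM].
have phiX n : phi (x ^+ n)%g = phi x ^+ n.
  by elim: n => [|n IHn]; rewrite ?expg0 ?phi1// expgS phiM IHn exprS.
by rewrite -phiX -cardsT expg_cardG ?inE.
Qed.

(** The irreducible characters of an abelian group are linear and their kernels meet
    trivially. They are valued in the algebraic numbers, and are carried to [C] through
    the exponents of their values in terms of a primitive root of unity. *)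
Lemma separating_group_character (C : numClosedFieldType) (gT : finGroupType) (g : gT) :
  abelian [set: gT] -> g != 1%g ->
  exists2 phi : gT -> C, is_group_character phi & phi g != 1.
Proof.
move=> abG g1.
have [i gi] : exists i, g \notin cfker 'chi[[set: gT]]_i.
  apply/existsP; rewrite -negb_forall; apply: contra g1 => /forallP h.
  have : g \in \bigcap_i cfker 'chi[[set: gT]]_i by apply/bigcapP => i _.
  by rewrite TI_cfker_irr inE.
have lin_i : 'chi_i \is a linear_char by move/char_abelianP: abG; apply.
have e0 : (0 < #|gT|)%N by rewrite -cardsT cardG_gt0.
have [w wP] := C_prim_root_exists e0.
have [z zP] := prim_root_exists C e0.
have rt x : {j : 'I_#|gT| | 'chi_i x = w ^+ j}.
  apply: (prim_rootP wP).
  by rewrite -lin_charX ?inE// -cardsT expg_cardG ?inE// lin_char1.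
pose f x := sval (rt x).
have fE x : 'chi_i x = w ^+ f x := svalP (rt x).
exists (fun x => z ^+ f x); first split.
- have : w ^+ f 1%g == w ^+ 0 by rewrite -fE lin_char1.
  by rewrite (eq_prim_root_expr wP) -(eq_prim_root_expr zP) => /eqP ->.
- move=> x y; rewrite -exprD; apply/eqP.
  by rewrite (eq_prim_root_expr zP) -(eq_prim_root_expr wP) exprD -!fE lin_charM ?inE.
apply: contra gi => zg.
have : z ^+ f g == z ^+ 0 by [].
rewrite (eq_prim_root_expr zP) -(eq_prim_root_expr wP) -fE => /eqP h.
by rewrite cfkerEirr inE h lin_char1.
Qed.

(** The values are powers of a primitive root of unity, so that a character is encoded
    by the function of its exponents. *)
Lemma group_characters_finite (C : numClosedFieldType) (gT : finGroupType) :
  exists (I : finType) (ev : I -> gT -> C), [/\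
    forall i, is_group_character (ev i),
    forall i j, ev i =1 ev j -> i = j &
    forall phi, is_group_character phi -> exists i, ev i =1 phi].
Proof.
have e0 : (0 < #|gT|)%N by rewrite -cardsT cardG_gt0.
have [z zP] := prim_root_exists C e0.
pose P := [pred f : {ffun gT -> 'I_#|gT|} | (z ^+ f 1%g == 1) &&
  [forall x, forall y, z ^+ f (x * y)%g == z ^+ f x * z ^+ f y]].
exists {f : {ffun gT -> 'I_#|gT|} | P f},
  (fun i x => z ^+ (val i : {ffun gT -> 'I_#|gT|}) x); split.
- move=> [f /= /andP[/eqP f1 /forallP fM]]; split => // x y.
  by apply/eqP; move: (fM x) => /forallP.
- move=> i j ij; apply/val_inj/ffunP => x; apply/val_inj/eqP.
  have := ij x => /eqP; rewrite (eq_prim_root_expr zP).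
  by rewrite !modn_small.
move=> phi phiP.
have rt x : {j : 'I_#|gT| | phi x = z ^+ j}.
  by apply: (prim_rootP zP); exact: group_character_card.
pose f := [ffun x => sval (rt x)].
have fE x : z ^+ f x = phi x by rewrite ffunE; exact/esym/(svalP (rt x)).
have [phi1 phiM] := phiP.
have Pf : P f.
  rewrite inE fE phi1 eqxx/=; apply/forallP => x; apply/forallP => y.
  by rewrite !fE phiM.
by exists (Sub f Pf) => x /=; rewrite fE.
Qed.

(** Translation by [g] multiplies the sum by [phi g]. *)
Lemma group_character_sum_eq0 (C : idomainType) (gT : finGroupType) (phi : gT -> C) :
  is_group_character phi -> (exists x, phi x != 1) -> \sum_x phi x = 0.
Proof.
move=> [_ phiM] [g g1].
have : (phi g - 1) * \sum_x phi x = 0.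
  rewrite mulrBl mul1r mulr_sumr; apply/eqP; rewrite subr_eq0; apply/eqP.
  by rewrite [RHS](reindex_inj (mulgI g)); apply: eq_bigr => x _; rewrite phiM.
by move/eqP; rewrite mulf_eq0 subr_eq0 (negbTE g1) => /eqP.
Qed.

(** Multiplication by a character [phi] with [phi g <> 1] permutes the characters and
    multiplies the sum by [phi g]. *)
Lemma sum_over_group_characters_eq0 (C : numClosedFieldType) (gT : finGroupType)
    (I : finType) (ev : I -> gT -> C) (g : gT) :
  (forall i, is_group_character (ev i)) -> (forall i j, ev i =1 ev j -> i = j) ->
  (forall phi, is_group_character phi -> exists i, ev i =1 phi) ->
  abelian [set: gT] -> g != 1%g -> \sum_i ev i g = 0.
Proof.
move=> evP ev_inj ev_all abG g1.
have [phi [phi1 phiM] phig] := separating_group_character C abG g1.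
have mulP i : exists j, ev j =1 (fun x => phi x * ev i x).
  have [ev1 evM] := evP i; apply: ev_all; split => [|x y]; first by rewrite phi1 ev1 mul1r.
  by rewrite phiM evM mulrACA.
have [h hE] := choice mulP.
have phi0 x : phi x != 0.
  have : phi x * phi x^-1%g = 1 by rewrite -phiM mulgV phi1.
  by apply: contra_eq_neq => ->; rewrite mul0r eq_sym oner_neq0.
have h_inj : injective h.
  move=> i j hij; apply: ev_inj => x; apply: (mulfI (phi0 x)).
  by rewrite -!hE hij.
have : (phi g - 1) * \sum_i ev i g = 0.
  rewrite mulrBl mul1r mulr_sumr; apply/eqP; rewrite subr_eq0; apply/eqP.
  by rewrite [RHS](reindex_inj h_inj); apply: eq_bigr => i _; rewrite hE.
by move/eqP; rewrite mulf_eq0 subr_eq0 (negbTE phig) => /eqP.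
Qed.

(** * Dirichlet characters *)

Lemma periodic_sum_bounded (R : realType) (a : nat -> R[i]) (k : nat) : (0 < k)%N ->
  (forall n, a (n + k)%N = a n) -> (forall n, normc (a n) <= 1) ->
  \sum_(0 <= n < k) a n = 0 ->
  forall m N, normc (\sum_(m <= n < N) a n) <= k%:R + k%:R.
Proof.
move=> k0 per a1 sum0 m N.
pose A N := \sum_(0 <= n < N) a n.
have AD j : A (j + k)%N = A j.
  rewrite /A addnC (big_cat_nat (n := k)) ?leq_addr//= sum0 add0r.
  rewrite -{1}[k]add0n big_addn addKn.
  by apply: eq_bigr => n _.
have Amod j : A j = A (j %% k)%N.
  rewrite {1}(divn_eq j k); elim: (j %/ k)%N => [|q IHq]; first by rewrite mul0n add0n.
  by rewrite mulSn -addnA addnC AD.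
have A_le j : normc (A j) <= k%:R.
  rewrite Amod; apply: le_trans (normc_sum _ _ _) _.
  apply: (@le_trans _ _ (\sum_(0 <= n < j %% k) (1 : R))); first exact: ler_sum.
  by rewrite sumr_const_nat subn0 ler_nat ltnW// ltn_pmod.
have [Nm|/ltnW mN] := leqP N m; first by rewrite big_geq// normc0 addr_ge0.
have -> : \sum_(m <= n < N) a n = A N + - A m.
  by rewrite [A N](big_cat_nat (n := m))//= addrAC subrr add0r.
by apply: le_trans (le_normcD _ _) _; rewrite normcN lerD.
Qed.

Lemma normc_root_of_unity (R : realType) (z : R[i]) (n : nat) : (0 < n)%N ->
  z ^+ n = 1 -> normc z = 1.
Proof.
move=> n0 zn.
have normcX m : normc (z ^+ m) = normc z ^+ m.
  by elim: m => [|m IHm]; rewrite ?expr0 ?normc1// !exprS normcM IHm.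
by apply/eqP; rewrite -(pexpr_eq1 n0) ?normc_ge0// -normcX zn normc1.
Qed.

Lemma mul_conjc_normc1 (R : realType) (z : R[i]) : normc z = 1 -> z^* * z = 1.
Proof.
case: z => x y /= h; have : x ^+ 2 + y ^+ 2 = 1.
  by rewrite -(sqr_sqrtr (_ : 0 <= x ^+ 2 + y ^+ 2)) ?h ?expr1n// addr_ge0 ?sqr_ge0.
move=> e; apply/eqP; rewrite eq_complex/= -e; apply/andP; split; apply/eqP; ring.
Qed.

(** The modulus is written [k.+2] because ['Z_m] is the ring of residues modulo [m] only
    for [m] at least 2. Off the residues prime to the modulus the value is the default 1,
    which [residue_lift] discards. *)
Definition Zp_unit_of_nat (k n : nat) : {unit 'Z_k.+2} :=
  insubd (1%g : {unit 'Z_k.+2}) (n%:R : 'Z_k.+2).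

Lemma Zp_unit_of_natE (k n : nat) : coprime k.+2 n ->
  val (Zp_unit_of_nat k n) = n%:R.
Proof. by move=> kn; rewrite val_insubd unitZpE// kn. Qed.

Lemma Zp_unit_of_natM (k m n : nat) : coprime k.+2 m -> coprime k.+2 n ->
  Zp_unit_of_nat k (m * n) = (Zp_unit_of_nat k m * Zp_unit_of_nat k n)%g.
Proof.
move=> km kn; apply: val_inj.
by rewrite /= !Zp_unit_of_natE ?coprimeMr ?km ?kn// natrM.
Qed.

Lemma natr_Zp_mod (k n : nat) : val (n%:R : 'Z_k.+2) = (n %% k.+2)%N.
Proof. by rewrite /= val_Zp_nat. Qed.

Lemma Zp_unit_of_nat_eq (k m n : nat) : coprime k.+2 m -> coprime k.+2 n ->
  (Zp_unit_of_nat k m == Zp_unit_of_nat k n) = (m == n %[mod k.+2]).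
Proof.
move=> km kn; rewrite -(inj_eq val_inj) !Zp_unit_of_natE// -(inj_eq val_inj).
by rewrite !natr_Zp_mod.
Qed.

Definition residue_lift (C : pzRingType) (k : nat) (phi : {unit 'Z_k.+2} -> C)
    (n : nat) : C :=
  if coprime k.+2 n then phi (Zp_unit_of_nat k n) else 0.

Lemma sum_residue_lift (C : pzRingType) (k : nat) (phi : {unit 'Z_k.+2} -> C) :
  \sum_(0 <= n < k.+2) residue_lift phi n = \sum_x phi x.
Proof.
rewrite big_mkord -big_mkcond/=.
rewrite (reindex_onto (fun x : {unit 'Z_k.+2} => val x)
   (fun n => Zp_unit_of_nat k (val n)))/=; last first.
  by move=> i ki; rewrite Zp_unit_of_natE// natr_Zp.
have valE (x : {unit 'Z_k.+2}) : Zp_unit_of_nat k (val (val x)) = x.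
  apply: val_inj; rewrite val_insubd natr_Zp.
  by have -> : val x \is a GRing.unit by exact: (valP x).
apply: eq_big => [x|x _]; last by rewrite valE.
rewrite valE eqxx andbT -unitZpE// natr_Zp.
exact: (valP x).
Qed.

Lemma residue_lift_character (C : pzRingType) (k : nat) (phi : {unit 'Z_k.+2} -> C) :
  is_group_character phi ->
  [/\ residue_lift phi 1 = 1, {morph residue_lift phi : m n / (m * n)%N >-> m * n} &
      forall n, residue_lift phi (n + k.+2) = residue_lift phi n].
Proof.
move=> [phi1 phiM]; split.
- rewrite /residue_lift coprimen1 (_ : Zp_unit_of_nat k 1 = 1%g) ?phi1//.
  by apply: val_inj; rewrite Zp_unit_of_natE ?coprimen1.
- move=> m n; rewrite /residue_lift coprimeMr.
  case: (boolP (coprime _ m)) => km; last by rewrite mul0r.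
  case: (boolP (coprime _ n)) => kn; last by rewrite mulr0.
  by rewrite Zp_unit_of_natM// phiM.
move=> n; rewrite /residue_lift.
have -> : coprime k.+2 (n + k.+2) = coprime k.+2 n by rewrite /coprime gcdnDr.
case: ifP => // kn; congr phi; apply/eqP.
by rewrite Zp_unit_of_nat_eq ?modnDr//; rewrite /coprime gcdnDr.
Qed.

(** These are the characters of the group of units modulo [k], extended by 0. They are
    valued in roots of unity, so conjugation inverts them, and orthogonality of the
    characters at [n / h] singles out the residue class of [h]. *)
Lemma dirichlet_characters (R : realType) (k : nat) : (1 < k)%N ->
  exists (I : finType) (chi : I -> nat -> R[i]) (i0 : I),
  [/\ forall n, chi i0 n = (coprime k n)%:R,
      forall i, i != i0 -> oscillating_character (chi i),
      forall i j, chi i =1 chi j -> i = j,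
      forall i, exists j, forall n, chi j n = (chi i n)^* &
      (forall i n, chi i n = 0 \/ normc (chi i n) = 1) /\
      forall h n, coprime k h ->
        \sum_i (chi i h)^* * chi i n = if n == h %[mod k] then #|I|%:R else 0].
Proof.
case: k => [|[|k]]// _.
have abG : abelian [set: {unit 'Z_k.+2}] by exact: units_Zp_abelian k.+2.
have [I [ev [evP ev_inj ev_all]]] := group_characters_finite R[i] {unit 'Z_k.+2}.
have [i0 ev0] : exists i, ev i =1 fun=> 1.
  by apply: ev_all; split => // x y; rewrite mulr1.
have card0 : (0 < #|[set: {unit 'Z_k.+2}]|)%N by rewrite cardG_gt0.
have ev_norm i x : normc (ev i x) = 1.
  apply: (normc_root_of_unity card0); rewrite cardsT; exact: group_character_card.
have evK i x : (ev i x)^* * ev i x = 1 by exact: mul_conjc_normc1.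
have evV i x : (ev i x)^* = ev i x^-1%g.
  have [ev1 evM] := evP i.
  by rewrite -[LHS]mulr1 -ev1 -(mulgV x) evM mulrA evK mul1r.
exists I, (fun i => residue_lift (ev i)), i0; split.
- by move=> n; rewrite /residue_lift; case: ifP => // _; rewrite ev0.
- move=> i ii0; have [r1 rM rD] := residue_lift_character (evP i).
  have r_le n : normc (residue_lift (ev i) n) <= 1.
    by rewrite /residue_lift; case: ifP; rewrite ?normc0// ev_norm.
  split => //; exists (k.+2%:R + k.+2%:R); apply: periodic_sum_bounded => //.
  rewrite sum_residue_lift; apply: group_character_sum_eq0 => //.
  have [//|h] := pselect (exists x, ev i x != 1).
  case/eqP: ii0; apply: ev_inj => x; rewrite ev0; apply/eqP/negPn/negP => hx.
  by apply: h; exists x.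
- move=> i j ij; apply: ev_inj => x.
  have kx : coprime k.+2 (val (val x)).
    by rewrite -unitZpE// natr_Zp; exact: (valP x).
  have := ij (val (val x)); rewrite /residue_lift kx.
  suff -> : Zp_unit_of_nat k (val (val x)) = x by [].
  by apply: val_inj; rewrite Zp_unit_of_natE// natr_Zp.
- move=> i; have [ev1 evM] := evP i.
  have [j jE] : exists j, ev j =1 fun x => (ev i x)^*.
    apply: ev_all; split => [|x y]; first by rewrite ev1; exact: rmorph1.
    by rewrite evM; exact: rmorphM.
  by exists j => n; rewrite /residue_lift jE; case: ifP => // _; exact/esym/rmorph0.
split=> [i n|h n kh].
  by rewrite /residue_lift; case: ifP => _; [right | left].
rewrite /residue_lift kh.
have [kn|kn] := boolP (coprime k.+2 n); last first.
  rewrite ifF; last first.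
    apply: contraNF kn => /eqP e; rewrite -coprime_modr e coprime_modr//.
  by rewrite big1// => i _; rewrite mulr0.
have -> : \sum_i (ev i (Zp_unit_of_nat k h))^* * ev i (Zp_unit_of_nat k n) =
    \sum_i ev i ((Zp_unit_of_nat k h)^-1 * Zp_unit_of_nat k n)%g.
  by apply: eq_bigr => i _; have [_ ->] := evP i; rewrite evV.
rewrite -Zp_unit_of_nat_eq//; case: eqP => [->|hn].
  rewrite mulVg; under eq_bigr => i _ do rewrite (proj1 (evP i)).
  by rewrite sumr_const.
apply: sum_over_group_characters_eq0 => //.
by apply/eqP => /eqP; rewrite -eq_mulVg1 => /eqP e; apply: hn.
Qed.

Lemma ln_unbounded (R : realType) (C : R) :
  exists2 N, (0 < N)%N & C < ln N%:R.
Proof.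
exists (Num.bound (expR C)).+1 => //.
rewrite -ltr_expR lnK ?posrE ?ltr0n//.
apply: lt_trans (archi_boundP (ltW (expR_gt0 C))) _.
by rewrite ltr_nat.
Qed.

Lemma Re_le_normc (R : realType) (z : R[i]) : Re z <= normc z.
Proof. exact: le_trans (ler_norm _) (normr_Re_le z). Qed.

Lemma Re_sum (R : realType) (I : Type) (r : seq I) (P : pred I) (F : I -> R[i]) :
  Re (\sum_(i <- r | P i) F i) = \sum_(i <- r | P i) Re (F i).
Proof. by apply: (big_morph _ _ (erefl _)) => -[? ?] [? ?]. Qed.

Lemma Lvalue_conj (R : realType) (chi : nat -> R[i]) :
  Lvalue chi 0 -> Lvalue (fun n => (chi n)^*) 0.
Proof.
move=> [D hD]; exists D => N; apply: le_trans (hD N); rewrite !subr0.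
have -> : Lsum (fun n => (chi n)^*) N = (Lsum chi N)^*.
  rewrite /Lsum rmorph_sum/=; apply: eq_bigr => n _.
  by rewrite [RHS]rmorphM; congr (_ * _); exact/esym/conjc_real.
by case: (Lsum chi N) => x y /=; rewrite sqrrN.
Qed.

(** * The principal character *)

Lemma Re_mangoldt_sum_principal (R : realType) (k : nat) (chi : nat -> R[i]) (N : nat) :
  (forall n, chi n = (coprime k n)%:R) ->
  Re (mangoldt_sum chi N) = \sum_(1 <= n < N.+1 | coprime k n) mangoldt R n / n%:R.
Proof.
move=> chiE; rewrite Re_sum [RHS]big_mkcond/=; apply: eq_bigr => n _.
by rewrite chiE; case: (coprime k n) => /=; rewrite ?mul1r ?mul0r ?subr0.
Qed.

Lemma sum_mangoldt_div_ge0 (R : realType) (P : pred nat) (m N : nat) :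
  0 <= \sum_(m <= n < N | P n) mangoldt R n / n%:R.
Proof. by apply: sumr_ge0 => n _; rewrite divr_ge0 ?mangoldt_ge0. Qed.

Lemma sum_mangoldt_div_support (R : realType) (P : pred nat) (N B : nat) :
  (forall n, P n -> (n <= B)%N) ->
  \sum_(1 <= n < N.+1 | P n) mangoldt R n / n%:R <=
  \sum_(1 <= n < B.+1) mangoldt R n / n%:R.
Proof.
move=> PB; rewrite (@big_nat_widen _ _ _ 1 N.+1 (maxn N.+1 B.+1)) ?leq_maxl//.
rewrite (@big_nat_widen _ _ _ 1 B.+1 (maxn N.+1 B.+1)) ?leq_maxr//.
rewrite big_mkcond [leRHS]big_mkcond; apply: ler_sum => n _ /=.
case: (boolP (P n)) => [/PB nB|_] /=; last by case: ifP; rewrite ?divr_ge0 ?mangoldt_ge0.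
have -> : (n < B.+1)%N by rewrite ltnS.
by case: ifP; rewrite ?divr_ge0 ?mangoldt_ge0.
Qed.

(** The primes dividing [k] are at most [k], and the other integers that share a
    factor with [k] contribute through proper prime powers only. *)
Lemma sum_mangoldt_coprime_ge (R : realType) (k : nat) : (0 < k)%N ->
  exists C, forall N, (0 < N)%N ->
    ln N%:R - C <= \sum_(1 <= n < N.+1 | coprime k n) mangoldt R n / n%:R.
Proof.
move=> k0; pose C0 := \sum_(1 <= n < k.+1) mangoldt R n / n%:R.
exists (1 + 2 + C0) => N N0.
have := sum_mangoldt_div_ge R N0.
rewrite (bigID (coprime k))/=.
suff : \sum_(1 <= n < N.+1 | ~~ coprime k n) mangoldt R n / n%:R <= 2 + C0 by lra.
rewrite (bigID prime)/= [leRHS]addrC; apply: lerD; last first.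
  apply: le_trans (sum_mangoldt_nonprime_le R N).
  rewrite big_mkcond [leRHS]big_mkcond/=; apply: ler_sum => n _.
  by case: (prime n); case: (coprime k n); rewrite //= divr_ge0 ?mangoldt_ge0.
apply: sum_mangoldt_div_support => n /andP[kn np].
by move: kn; rewrite coprime_sym prime_coprime// negbK => /(dvdn_leq k0).
Qed.

(** * Nonvanishing at 1 *)

Lemma sum_characters_mangoldt (R : realType) (k h : nat) (I : finType)
    (chi : I -> nat -> R[i]) (N : nat) :
  (forall n, \sum_i (chi i h)^* * chi i n = if n == h %[mod k] then #|I|%:R else 0) ->
  \sum_i Re ((chi i h)^* * mangoldt_sum (chi i) N) =
  #|I|%:R * \sum_(1 <= n < N.+1 | n == h %[mod k]) mangoldt R n / n%:R.
Proof.
move=> orth; rewrite -Re_sum.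
under eq_bigr => i _ do rewrite mulr_sumr.
rewrite exchange_big/= Re_sum mulr_sumr [RHS]big_mkcond/=; apply: eq_bigr => n _.
under eq_bigr => i _ do rewrite mulrA.
rewrite -mulr_suml orth; case: ifP => _; last by rewrite mul0r.
by rewrite -[#|I|%:R](rmorph_nat (real_complex R)) -rmorphM.
Qed.

Lemma real_character_Lvalue_neq0 (R : realType) (chi : nat -> R[i]) :
  (forall n, chi n = 0 \/ normc (chi n) = 1) -> oscillating_character chi ->
  (forall n, (chi n)^* = chi n) -> ~ Lvalue chi 0.
Proof.
move=> norm01 chiP real.
have E : chi = fun n => (Re (chi n))%:C.
  apply/funext => n; have := real n; case: (chi n) => x y [] h /=.
  by congr (_ +i* _); move: h; lra.
rewrite E in chiP *; apply: real_char_Lvalue_neq0 => // n.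
rewrite !inE; case: (norm01 n) => [->|]; first by rewrite eqxx.
rewrite E normc_real => /eqP; rewrite eqr_norml ler01 andbT.
by case/orP => /eqP ->; rewrite eqxx ?orbT.
Qed.

(** Two distinct characters whose L-functions vanish at 1 would each contribute
    [- ln N] to the sum over all characters, against only [ln N] from the principal
    one, whereas that sum is nonnegative. So a vanishing character would equal its own
    conjugate, and the real case is excluded. *)
Lemma dirichlet_Lvalue_neq0 (R : realType) (k : nat) (I : finType)
    (chi : I -> nat -> R[i]) (i0 : I) :
  (forall n, chi i0 n = (coprime k n)%:R) ->
  (forall i, i != i0 -> oscillating_character (chi i)) ->
  (forall i j, chi i =1 chi j -> i = j) ->
  (forall i, exists j, forall n, chi j n = (chi i n)^*) ->
  (forall i n, chi i n = 0 \/ normc (chi i n) = 1) ->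
  (forall h n, coprime k h ->
     \sum_i (chi i h)^* * chi i n = if n == h %[mod k] then #|I|%:R else 0) ->
  forall i, i != i0 -> ~ Lvalue (chi i) 0.
Proof.
move=> chi0 chiP chi_inj chi_conj norm01 orth i ii0 Li0.
have [j jE] := chi_conj i.
have [ij|ij] := eqVneq i j.
  apply: (real_character_Lvalue_neq0 (norm01 i) (chiP _ ii0)) => // n.
  by rewrite -jE -ij.
have ji0 : j != i0.
  apply: contra_neq ii0 => ji0; apply: chi_inj => n.
  have := jE n; rewrite ji0 chi0 => /(congr1 conjc); rewrite conjcK => <-.
  exact: rmorph_nat.
have Lj0 : Lvalue (chi j) 0.
  by have := Lvalue_conj Li0; congr Lvalue; apply/funext => n; rewrite jE.
have bound l : l != i0 -> exists K, forall N, (0 < N)%N -> Re (mangoldt_sum (chi l) N) <= K.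
  move=> li0; have [L LP] := Lvalue_exists (chiP _ li0).
  have [L0|L0] := eqVneq L 0.
    rewrite L0 in LP; have [D hD] := mangoldt_sum_Lvalue0 (chiP _ li0) LP.
    exists D => N N0; apply: le_trans (hD N N0); apply: le_trans (Re_le_normc _).
    by case: (mangoldt_sum _ _) => x y /=; rewrite lerDl ln_nat_ge0.
  have [K hK] := mangoldt_sum_bounded (chiP _ li0) LP L0.
  by exists K => N _; apply: le_trans (Re_le_normc _) (hK N).
have [K hK] : exists K : I -> R, forall l, l != i0 ->
    forall N, (0 < N)%N -> Re (mangoldt_sum (chi l) N) <= K l.
  have /choice [K hK] : forall l, exists x : R, l != i0 ->
      forall N, (0 < N)%N -> Re (mangoldt_sum (chi l) N) <= x.
    move=> l; have [->|li0] := eqVneq l i0; first by exists 0.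
    by have [x hx] := bound l li0; exists x.
  by exists K.
have vanish l : l != i0 -> Lvalue (chi l) 0 -> exists D, forall N, (0 < N)%N ->
    Re (mangoldt_sum (chi l) N) <= D - ln N%:R.
  move=> li0 LP; have [D hD] := mangoldt_sum_Lvalue0 (chiP _ li0) LP.
  exists D => N N0; rewrite lerBrDr; apply: le_trans (hD N N0).
  by apply: le_trans (Re_le_normc _); case: (mangoldt_sum _ _).
have [Di hDi] := vanish _ ii0 Li0.
have [Dj hDj] := vanish _ ji0 Lj0.
pose C := 4 + Di + Dj + \sum_(l | [&& l != i0, l != i & l != j]) K l.
have [N N0 hN] := ln_unbounded C.
have := sum_characters_mangoldt N (fun n => orth 1%N n (coprimen1 k)).
have chi1 l : (chi l 1)^* = 1.
  have [->|li0] := eqVneq l i0; first by rewrite chi0 coprimen1; exact: rmorph1.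
  by have [-> _ _ _] := chiP _ li0; exact: rmorph1.
under eq_bigr => l _ do rewrite chi1 mul1r.
rewrite (bigD1 i0)//= (bigD1 i)//= (bigD1 j)/=; last by rewrite ji0 eq_sym ij.
rewrite (Re_mangoldt_sum_principal _ chi0) => E.
have R0 : 0 <= #|I|%:R * \sum_(1 <= n < N.+1 | n == 1 %[mod k]) mangoldt R n / n%:R.
  by rewrite mulr_ge0// sum_mangoldt_div_ge0.
have h0 : \sum_(1 <= n < N.+1 | coprime k n) mangoldt R n / n%:R <= ln N%:R + 4.
  apply: le_trans (sum_mangoldt_div_le R N0).
  by rewrite [leRHS](bigID (coprime k))/= lerDl sum_mangoldt_div_ge0.
have h3 : \sum_(l | (l != i0) && (l != i) && (l != j)) Re (mangoldt_sum (chi l) N) <=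
    \sum_(l | [&& l != i0, l != i & l != j]) K l.
  under eq_bigl => l do rewrite -andbA.
  by apply: ler_sum => l /and3P[li0 _ _]; apply: hK.
have := hDi N N0; have := hDj N N0; move: hN; rewrite /C; lra.
Qed.

(** * Dirichlet's theorem *)

(** By orthogonality, the sum over the class of [h] is, up to the factor [#|I|], a
    combination of the [mangoldt_sum] of all characters, with coefficient 1 at the
    principal one and coefficients of norm at most 1 at the others, which are bounded. *)
Lemma sum_mangoldt_progression_unbounded (R : realType) (k h : nat) :
  (1 < k)%N -> coprime k h ->
  forall C : R, exists N,
    C < \sum_(1 <= n < N.+1 | n == h %[mod k]) mangoldt R n / n%:R.
Proof.
move=> k1 kh C.
have [I [chi [i0 [chi0 chiP chi_inj chi_conj [norm01 orth]]]]] :=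
  dirichlet_characters R k1.
have L_neq0 := dirichlet_Lvalue_neq0 chi0 chiP chi_inj chi_conj norm01 orth.
have I0 : (0 : R) < #|I|%:R by rewrite ltr0n; apply/card_gt0P; exists i0.
have [K hK] : exists K : I -> R, forall l, l != i0 ->
    forall N, normc (mangoldt_sum (chi l) N) <= K l.
  have /choice [K hK] : forall l, exists x : R, l != i0 ->
      forall N, normc (mangoldt_sum (chi l) N) <= x.
    move=> l; have [->|li0] := eqVneq l i0; first by exists 0.
    have [L LP] := Lvalue_exists (chiP _ li0).
    have L0 : L != 0 by apply/eqP => L0; apply: (L_neq0 _ li0); rewrite -L0.
    by have [x hx] := mangoldt_sum_bounded (chiP _ li0) LP L0; exists x.
  by exists K.
have [C0 hC0] := sum_mangoldt_coprime_ge R (ltnW k1).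
have [N N0 hN] := ln_unbounded (#|I|%:R * C + C0 + \sum_(l | l != i0) K l).
exists N; rewrite -(ltr_pM2l I0) -(sum_characters_mangoldt N (orth h ^~ kh)).
rewrite (bigD1 i0)//= chi0 kh [(_)^*]rmorph1 mul1r.
rewrite (Re_mangoldt_sum_principal _ chi0).
have h1 : - \sum_(l | l != i0) K l <=
    \sum_(l | l != i0) Re ((chi l h)^* * mangoldt_sum (chi l) N).
  rewrite -sumrN; apply: ler_sum => l li0.
  have b : normc ((chi l h)^* * mangoldt_sum (chi l) N) <= K l.
    rewrite normcM -[K l]mul1r ler_pM ?normc_ge0//; last exact: hK.
    have -> : normc (chi l h)^* = normc (chi l h).
      by case: (chi l h) => x y /=; rewrite sqrrN.
    by case: (norm01 l h) => ->; rewrite ?normc0.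
  by have := le_trans (normr_Re_le _) b; rewrite ler_norml => /andP[].
by have := hC0 N N0; lra.
Qed.

(** Proper prime powers and the primes up to [B] add up to at most a constant, which the
    sum over the progression exceeds. *)
Theorem dirichlet_primes (R : realType) (k h B : nat) : (0 < k)%N -> coprime k h ->
  exists p, [/\ prime p, (B < p)%N & p = h %[mod k]].
Proof.
(* a modulus 1 is replaced by 2, which does not constrain the residue *)
wlog k1 : k h / (1 < k)%N => [H k0 kh|_ kh].
  have [k1|k1] := ltnP 1 k; first exact: H.
  have -> : k = 1%N by lia.
  have [p [pp Bp _]] := H 2 1%N isT isT isT.
  by exists p; split; rewrite ?modn1.
pose C := 2 + \sum_(1 <= n < B.+1) mangoldt R n / n%:R.
have [N hN] := sum_mangoldt_progression_unbounded k1 kh C.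
have [//|none] := pselect (exists p, [/\ prime p, (B < p)%N & p = h %[mod k]]).
exfalso; move: hN; rewrite ltNge => /negP; apply.
rewrite (bigID prime)/= addrC; apply: lerD.
  apply: le_trans (sum_mangoldt_nonprime_le R N).
  rewrite big_mkcond [leRHS]big_mkcond/=; apply: ler_sum => n _.
  by case: (prime n); case: (n == h %[mod k]); rewrite //= divr_ge0 ?mangoldt_ge0.
apply: sum_mangoldt_div_support => n /andP[/eqP nh np].
by rewrite leqNgt; apply/negP => Bn; apply: none; exists n.
Qed.

(** * Arithmetic of [gamma], [tau] and [totient] *)

Lemma totient_primeM_dvd (p m : nat) : prime p -> (0 < m)%N -> (p %| m)%N ->
  totient (m * p) = (totient m * p)%N.
Proof.
move=> pp m0 pm; have [n cn mE] := pfactor_coprime pp m0.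
have v0 : (0 < logn p m)%N by rewrite logn_gt0 mem_primes pp m0.
rewrite mE -mulnA -expnSr !totient_coprime ?coprime_expr ?(coprime_sym n)//.
  rewrite !totient_pfactor//= -!mulnA; congr (_ * (_ * _))%N.
  by rewrite -{1}(prednK v0) expnSr.
all: by rewrite coprimeXl ?(coprime_sym n).
Qed.

(** A prime that already divides [g] multiplies [totient] by itself; [c] is built from
    such primes. *)
Lemma totientM_dvd (g c : nat) : (0 < g)%N -> (0 < c)%N ->
  (forall p, prime p -> (p %| c)%N -> (p %| g)%N) ->
  totient (g * c) = (totient g * c)%N.
Proof.
elim/ltn_ind: c g => c IHc g g0 c0 cg.
have [c1|c1] := leqP c 1; first by have -> : c = 1%N by [lia]; rewrite !muln1.
have pp := pdiv_prime c1; have pc := pdiv_dvd c; set p := pdiv c in pp pc.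
have cE : c = (p * (c %/ p))%N by rewrite mulnC divnK.
have q0 : (0 < c %/ p)%N by rewrite divn_gt0 ?prime_gt0// dvdn_leq.
have qc : (c %/ p < c)%N by rewrite ltn_Pdiv ?prime_gt1.
rewrite {1}cE mulnA IHc//.
- by rewrite totient_primeM_dvd ?cg// -mulnA -cE.
- by rewrite muln_gt0 g0 prime_gt0.
by move=> r pr rc; rewrite dvdn_mulr// cg// cE dvdn_mull.
Qed.

(** The factor [1 - 1 / p] of Euler's product. *)
Lemma totient_prime_le (p m : nat) : prime p -> (0 < m)%N -> (p %| m)%N ->
  (p * totient m <= (p.-1) * m)%N.
Proof.
move=> pp m0 pm; have [n cn mE] := pfactor_coprime pp m0.
have v0 : (0 < logn p m)%N by rewrite logn_gt0 mem_primes pp m0.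
have tn : (totient n <= n)%N.
  rewrite totient_count_coprime -[leqRHS]subn0 -[leqRHS]muln1 -sum_nat_const_nat.
  by apply: leq_sum => i _; exact: leq_b1.
have e : (p ^ logn p m = p * p ^ (logn p m).-1)%N by rewrite -expnS prednK.
rewrite {1}mE totient_coprime ?coprimeXr ?(coprime_sym n)// totient_pfactor//.
rewrite [X in (_ <= _ * X)%N]mE e.
have -> : (p * (totient n * (p.-1 * p ^ (logn p m).-1)) =
  totient n * (p.-1 * (p * p ^ (logn p m).-1)))%N by ring.
have -> : (p.-1 * (n * (p * p ^ (logn p m).-1)) =
  n * (p.-1 * (p * p ^ (logn p m).-1)))%N by ring.
by rewrite leq_mul2r tn orbT.
Qed.

Lemma totient_lt (m : nat) : (1 < m)%N -> (totient m < m)%N.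
Proof.
move=> m1; have pp := pdiv_prime m1.
have := totient_prime_le pp (ltnW m1) (pdiv_dvd m).
have := prime_gt1 pp; set p := pdiv m => p1 h.
have p0 : (0 < p)%N by exact: ltnW.
rewrite -(ltn_pmul2l p0); apply: leq_ltn_trans h _.
by rewrite ltn_pmul2r ?(ltnW m1)// prednK.
Qed.

Lemma gamma_tau (g : nat) (r : int) : r != 0 -> (gamma g%:Z r * tau g%:Z r = `|r|)%N.
Proof.
move=> r0; have r0' : (0 < `|r|)%N by rewrite absz_gt0.
rewrite [RHS](prod_prime_decomp r0') prime_decompE big_map/=.
by rewrite (bigID (fun p : nat => (p%:Z %| g%:Z)%Z))/=.
Qed.

Lemma prime_dvd_pfactor_prod (P : pred nat) (M p : nat) : prime p ->
  (p %| \prod_(q <- primes M | P q) q ^ logn q M)%N = (p \in primes M) && P p.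
Proof.
move=> pp; rewrite Euclid_dvd_prod//; apply/idP/idP.
  rewrite big_has_cond => /hasP[q qM /= /andP[Pq]].
  have qp : prime q by move: qM; rewrite mem_primes => /andP[].
  rewrite Euclid_dvdX// => /andP[+ _]; rewrite dvdn_prime2// => /eqP ->.
  by rewrite qM Pq.
move=> /andP[pM Pp]; rewrite big_has_cond; apply/hasP; exists p => //=.
by rewrite Pp Euclid_dvdX// dvdnn logn_gt0.
Qed.

Lemma prime_dvd_gamma (g : nat) (r : int) (p : nat) : prime p ->
  (p %| gamma g%:Z r)%N = (p \in primes `|r|) && (p %| g)%N.
Proof. by move=> pp; rewrite /gamma prime_dvd_pfactor_prod// dvdzE. Qed.

Lemma prime_dvd_tau (g : nat) (r : int) (p : nat) : prime p ->
  (p %| tau g%:Z r)%N = (p \in primes `|r|) && ~~ (p %| g)%N.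
Proof. by move=> pp; rewrite /tau prime_dvd_pfactor_prod// dvdzE. Qed.

Lemma gamma_gt0 (g : nat) (r : int) : r != 0 -> (0 < gamma g%:Z r)%N.
Proof.
by move=> r0; have := absz_gt0 r; rewrite r0 -(gamma_tau g r0) muln_gt0 => /andP[].
Qed.

Lemma tau_gt0 (g : nat) (r : int) : r != 0 -> (0 < tau g%:Z r)%N.
Proof.
by move=> r0; have := absz_gt0 r; rewrite r0 -(gamma_tau g r0) muln_gt0 => /andP[].
Qed.

(** All primes of [gamma g r] divide [g], and none of [tau g r] does. *)
Lemma totient_gamma_tau (g : nat) (r : int) : (0 < g)%N -> r != 0 ->
  totient (g * `|r|) = (totient g * (gamma g%:Z r * totient (tau g%:Z r)))%N.
Proof.
move=> g0 r0; have c0 := gamma_gt0 g r0; have t0 := tau_gt0 g r0.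
rewrite -(gamma_tau g r0) mulnA totient_coprime.
  rewrite totientM_dvd ?mulnA// => p pp.
  by rewrite prime_dvd_gamma// => /andP[].
rewrite coprime_has_primes ?muln_gt0 ?g0//; apply/hasPn => p.
rewrite mem_primes => /and3P[pp _]; rewrite prime_dvd_tau// => /andP[_ pg].
rewrite /= mem_primes pp muln_gt0 g0 c0/= Euclid_dvdM// (negbTE pg)/=.
by rewrite prime_dvd_gamma// (negbTE pg) andbF.
Qed.

Lemma tau_ge2P (g : nat) (r : int) : r != 0 ->
  reflect (exists p, [/\ prime p, (p %| `|r|)%N & ~~ (p %| g)%N])
    (2 <= tau g%:Z r)%N.
Proof.
move=> r0; have r0' : (0 < `|r|)%N by rewrite absz_gt0.
apply: (iffP idP) => [t2|[p [pp pr pg]]].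
  exists (pdiv (tau g%:Z r)); have pp := pdiv_prime t2.
  have := pdiv_dvd (tau g%:Z r); rewrite prime_dvd_tau// mem_primes.
  by move=> /andP[/and3P[_ _ h] h']; split.
have : (p %| tau g%:Z r)%N by rewrite prime_dvd_tau// mem_primes pp r0' pr.
move=> /(dvdn_leq (tau_gt0 g r0)); apply: leq_trans; exact: prime_gt1.
Qed.

Lemma rad_dvdP (r : int) (g : nat) : r != 0 ->
  reflect (forall p, prime p -> (p %| `|r|)%N -> (p %| g)%N) (rad r %| g)%N.
Proof.
move=> r0; have r0' : (0 < `|r|)%N by rewrite absz_gt0.
apply: (iffP idP) => [h p pp pr|h].
  apply: dvdn_trans h; rewrite /rad (bigD1_seq p) ?primes_uniq//=.
    exact: dvdn_mulr.
  by rewrite mem_primes pp r0'.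
have {}h : all (fun p => prime p && (p %| g)%N) (primes `|r|).
  by apply/allP => p; rewrite mem_primes => /and3P[pp _ /(h _ pp) ->]; rewrite pp.
rewrite /rad; elim: (primes `|r|) (primes_uniq `|r|) h => [|p s IHs].
  by rewrite big_nil dvd1n.
rewrite /= => /andP[ps us] /andP[/andP[pp pg] hs].
rewrite big_cons Gauss_dvd ?pg ?IHs//.
rewrite prime_coprime// Euclid_dvd_prod// big_has; apply: contra ps => /hasP[q qs].
have /andP[qp _] := allP hs q qs.
by rewrite dvdn_prime2// => /eqP ->.
Qed.

Lemma rad_dvd_tau (r : int) (g : nat) : r != 0 ->
  (rad r %| g)%N = ~~ (2 <= tau g%:Z r)%N.
Proof.
move=> r0; apply/rad_dvdP/negP => // [h /tau_ge2P|h p pp pr].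
  by move=> /(_ r0)[p [pp pr]]; rewrite h.
by apply/negPn/negP => pg; apply: h; apply/tau_ge2P => //; exists p.
Qed.

(** * The progression [a n + b = g r_n] *)

Lemma gg_gt0 (a : nat) (b : int) : (0 < a)%N -> (0 < gg a b)%N.
Proof. by move=> a0; rewrite gcdn_gt0 a0. Qed.

Lemma aqK (a : nat) (b : int) : (aq a b * gg a b)%N = a.
Proof. by rewrite divnK// dvdn_gcdl. Qed.

Lemma bqK (a : nat) (b : int) : bq a b * (gg a b)%:Z = b.
Proof. by rewrite divzK// dvdzE/= dvdn_gcdr. Qed.

Lemma aq_gt0 (a : nat) (b : int) : (0 < a)%N -> (0 < aq a b)%N.
Proof. by move=> a0; rewrite divn_gt0 ?gg_gt0// dvdn_leq// dvdn_gcdl. Qed.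

Lemma coprime_aq_bq (a : nat) (b : int) : (0 < a)%N -> coprime (aq a b) `|bq a b|.
Proof.
move=> a0; have g0 := gg_gt0 b a0; rewrite /coprime -(eqn_pmul2r g0) mul1n.
have -> : (gcdn (aq a b) `|bq a b| * gg a b)%N =
    gcdn (aq a b * gg a b) (`|bq a b| * gg a b) by rewrite muln_gcdl.
by rewrite aqK -[(_ * gg a b)%N](abszM _ (gg a b)%:Z) bqK.
Qed.

Lemma rn_mul_gg (a : nat) (b : int) (n : nat) :
  a%:Z * n%:Z + b = rn a b n * (gg a b)%:Z.
Proof. by rewrite /rn mulrDl bqK mulrAC -[_ * (gg a b)%:Z]PoszM aqK. Qed.

Lemma rnE (R : realType) (a : nat) (b : int) (n : nat) :
  (rn a b n)%:~R = (aq a b)%:R * n%:R + (bq a b)%:~R :> R.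
Proof. by rewrite /rn rmorphD rmorphM. Qed.

Lemma ratio_bq (R : realType) (a : nat) (b : int) : (0 < a)%N ->
  b%:~R / a%:R = (bq a b)%:~R / (aq a b)%:R :> R.
Proof.
move=> a0; have gR : (gg a b)%:R != 0 :> R by rewrite pnatr_eq0 -lt0n gg_gt0.
have qR : (aq a b)%:R != 0 :> R by rewrite pnatr_eq0 -lt0n aq_gt0.
have -> : b%:~R = (bq a b)%:~R * (gg a b)%:R :> R by rewrite -{1}(bqK a b) rmorphM.
have -> : a%:R = (aq a b)%:R * (gg a b)%:R :> R by rewrite -{1}(aqK a b) natrM.
by field; rewrite gR qR.
Qed.

Lemma ratio_bq1 (R : realType) (a : nat) (b : int) : (0 < a)%N ->
  (b - (gg a b)%:Z)%:~R / a%:R = ((bq a b)%:~R - 1) / (aq a b)%:R :> R.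
Proof.
move=> a0; have gR : (gg a b)%:R != 0 :> R by rewrite pnatr_eq0 -lt0n gg_gt0.
have qR : (aq a b)%:R != 0 :> R by rewrite pnatr_eq0 -lt0n aq_gt0.
rewrite rmorphB mulrBl mulrBl mul1r (ratio_bq R b a0) /=; congr (_ - _).
have -> : a%:R = (aq a b)%:R * (gg a b)%:R :> R by rewrite -{1}(aqK a b) natrM.
by field; rewrite gR qR.
Qed.

Lemma Nabove_rn (R : realType) (a : nat) (b : int) (n : nat) : (0 < a)%N ->
  (- (b%:~R / a%:R) < n%:R :> R) = (0 < rn a b n).
Proof.
move=> a0; rewrite ratio_bq// -(ltr0z R) rnE.
have qR : (0 : R) < (aq a b)%:R by rewrite ltr0n aq_gt0.
by rewrite -mulNr ltr_pdivrMr// -[LHS]subr_gt0 opprK mulrC.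
Qed.

(** What remains of [totient (an + b)] after division by [totient g]. *)
Definition weight (a : nat) (b : int) (n : nat) : nat :=
  (gamma (gg a b)%:Z (rn a b n) * totient (tau (gg a b)%:Z (rn a b n)))%N.

(** Since [an + b = g r_n], the factor [totient g] cancels. The condition [n > - d / c]
    follows from the inequality, the weight being positive. *)
Lemma MsetP (R : realType) (a : nat) (b : int) (c d : R) (n : nat) :
  (0 < a)%N -> 0 < c ->
  Mset a b c d n <->
  [/\ (0 < n)%N, 0 < rn a b n & (weight a b n)%:R / (aq a b)%:R - d / c <= n%:R].
Proof.
move=> a0 c0; have g0 := gg_gt0 b a0.
have gR : (0 : R) < (gg a b)%:R by rewrite ltr0n.
have qR : (0 : R) < (aq a b)%:R by rewrite ltr0n aq_gt0.
have tgR : (0 : R) < (totient (gg a b))%:R by rewrite ltr0n totient_gt0.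
have E : 0 < rn a b n -> totient `|(a%:Z * n%:Z + b)%R|%N =
    (totient (gg a b) * weight a b n)%N.
  move=> r0; rewrite rn_mul_gg abszM mulnC totient_gamma_tau//.
  by rewrite gt_eqF.
have W0 : 0 < rn a b n -> (0 : R) < (weight a b n)%:R.
  by move=> r0; rewrite ltr0n muln_gt0 gamma_gt0 ?totient_gt0 ?tau_gt0// gt_eqF.
have K : 0 < rn a b n -> - (d / c) < n%:R ->
    ((totient `|(a%:Z * n%:Z + b)%R|%N)%:R / (c * n%:R + d)
       <= (a%:R * (totient (gg a b))%:R) / (c * (gg a b)%:R)) =
    ((weight a b n)%:R / (aq a b)%:R - d / c <= n%:R).
  move=> r0 dn; rewrite E//.
  have den : 0 < c * n%:R + d.
    by move: dn; rewrite -mulNr ltr_pdivrMr// mulrC; lra.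
  have -> : a%:R = (aq a b)%:R * (gg a b)%:R :> R by rewrite -{1}(aqK a b) natrM.
  rewrite natrM ler_pdivrMr// lerBlDr ler_pdivrMr//.
  have -> : (aq a b)%:R * (gg a b)%:R * (totient (gg a b))%:R /
      (c * (gg a b)%:R) * (c * n%:R + d) =
    (totient (gg a b))%:R * ((n%:R + d / c) * (aq a b)%:R).
    by field; rewrite !gt_eqF.
  by rewrite ler_pM2l.
split.
  move=> [n0]; rewrite gt_max Nabove_rn// => /andP[r0 dn]; rewrite K//.
move=> [n0 r0 h]; have dn : - (d / c) < n%:R.
  by apply: lt_le_trans h; rewrite ltrDr divr_gt0// W0.
by split => //; [rewrite gt_max Nabove_rn// r0 | rewrite K].
Qed.

Lemma weight_le (a : nat) (b : int) (n : nat) : 0 < rn a b n ->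
  (weight a b n <= `|rn a b n|)%N.
Proof.
move=> r0; have r0' : rn a b n != 0 by rewrite gt_eqF.
rewrite -(gamma_tau (gg a b) r0') leq_mul2l orbC.
have t0 := tau_gt0 (gg a b) r0'.
have [t1|t1] := leqP (tau (gg a b)%:Z (rn a b n)) 1; last by rewrite ltnW// totient_lt.
by have -> : tau (gg a b)%:Z (rn a b n) = 1%N by [lia].
Qed.

Lemma weight_lt (a : nat) (b : int) (n : nat) : 0 < rn a b n ->
  (2 <= tau (gg a b)%:Z (rn a b n))%N -> (weight a b n < `|rn a b n|)%N.
Proof.
move=> r0 t2; have r0' : rn a b n != 0 by rewrite gt_eqF.
by rewrite -(gamma_tau (gg a b) r0') ltn_mul2l gamma_gt0//= totient_lt.
Qed.

Lemma weight_Rset (a : nat) (b : int) (n : nat) : 0 < rn a b n ->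
  (rad (rn a b n) %| gg a b)%N -> weight a b n = `|rn a b n|%N.
Proof.
move=> r0; have r0' : rn a b n != 0 by rewrite gt_eqF.
rewrite rad_dvd_tau// -leqNgt => t1; have t0 := tau_gt0 (gg a b) r0'.
have tE : tau (gg a b)%:Z (rn a b n) = 1%N by lia.
by rewrite /weight -[RHS](gamma_tau (gg a b) r0') tE.
Qed.

Lemma Pset_tau (a : nat) (b : int) (n : nat) : Pset a b n ->
  tau (gg a b)%:Z (rn a b n) = `|rn a b n|%N /\ gamma (gg a b)%:Z (rn a b n) = 1%N.
Proof.
move=> [_ [[r0 rp] rg]]; have rg' : ~~ (`|rn a b n| %| gg a b)%N.
  by apply/negP => h; apply: rg; rewrite dvdzE.
have -> : gamma (gg a b)%:Z (rn a b n) = 1%N.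
  by rewrite /gamma primes_prime// big_cons big_nil dvdzE/= (negbTE rg').
split=> //; rewrite /tau primes_prime// big_cons big_nil dvdzE/= rg' muln1.
by rewrite logn_prime// eqxx expn1.
Qed.

Lemma infinite_set_unbounded (A : set nat) :
  (forall N, exists2 n, A n & (N < n)%N) -> infinite_set A.
Proof.
move=> h /finite_seqP[s As]; have [n An] := h (\max_(i <- s) i)%N.
rewrite ltnNge => /negP; apply.
by move: An; rewrite As /= => ns; apply: (@leq_bigmax_seq _ s xpredT (fun i => i)).
Qed.

(** Fix a prime [s] not dividing [a]. For [n] in a suitable class modulo [s] it divides
    [tau g r_n], so that the weight of [n] is at most [(1 - 1 / s) r_n], which leaves
    room for any constant [d / c] once [n] is large. *)
Lemma Mset_infinite (R : realType) (a : nat) (b : int) (c d : R) :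
  (0 < a)%N -> 0 < c -> infinite_set (Mset a b c d).
Proof.
move=> a0 c0; apply: infinite_set_unbounded => N.
have [s sa sp] := prime_above a.
have s1 := prime_gt1 sp.
have q0 := aq_gt0 b a0.
have sq : coprime (aq a b) s.
  rewrite coprime_sym prime_coprime//; apply/negP => /(dvdn_leq q0) h.
  have : (aq a b <= a)%N by rewrite leq_div.
  by lia.
have sg : ~~ (s %| gg a b)%N.
  apply/negP => /(dvdn_leq (gg_gt0 b a0)) h.
  have : (gg a b <= a)%N by rewrite dvdn_leq// dvdn_gcdl.
  by lia.
have [n0 n0P] : exists n0 : nat, (s%:Z %| rn a b n0)%Z.
  have /coprimezP[[u v] /= uv] : coprimez (aq a b)%:Z s%:Z by [].
  have m0 : 0 <= ((- bq a b * u) %% s%:Z)%Z by rewrite modz_ge0//; lia.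
  exists `|((- bq a b * u) %% s%:Z)%Z|%N; rewrite /rn gez0_abs//.
  apply/dvdzP; exists (bq a b * v - (aq a b)%:Z * ((- bq a b * u) %/ s%:Z)%Z).
  have := divz_eq (- bq a b * u) s%:Z.
  move: (divz _ _) (modz _ _) => x y xy.
  have -> : y = - bq a b * u - x * s%:Z by rewrite xy addrC addKr.
  rewrite -{2}[bq a b]mulr1 -{1}uv; ring.
have sR : (0 : R) < s%:R by rewrite ltr0n prime_gt0.
have qR : (0 : R) < (aq a b)%:R by rewrite ltr0n.
pose t := (N + `|bq a b| + Num.bound (s%:R * (`|bq a b|%:R + `|d / c| ) : R))%N.
pose n := (n0 + s * t.+1)%N.
have tn : (t < n)%N by rewrite /n; nia.
have rE : rn a b n = rn a b n0 + s%:Z * ((aq a b)%:Z * t.+1%:Z).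
  by rewrite /rn /n PoszD PoszM; ring.
have sr : (s %| `|rn a b n|)%N.
  have : (s%:Z %| rn a b n)%Z by rewrite rE rpredD// dvdz_mulr.
  by rewrite dvdzE.
have r0 : 0 < rn a b n.
  rewrite /rn; have : (`|bq a b| < n)%N by apply: leq_ltn_trans tn; rewrite /t; lia.
  by move: q0; nia.
have r0' : rn a b n != 0 by rewrite gt_eqF.
exists n; last by apply: leq_ltn_trans tn; rewrite /t; lia.
apply/MsetP => //; split => //; first by rewrite (leq_ltn_trans _ tn).
have st : (s %| tau (gg a b)%:Z (rn a b n))%N.
  by rewrite prime_dvd_tau// mem_primes sp sr absz_gt0 r0'.
have sw : (s * weight a b n <= s.-1 * `|rn a b n|)%N.
  rewrite -(gamma_tau (gg a b) r0') /weight mulnCA [leqRHS]mulnCA leq_mul2l.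
  by rewrite totient_prime_le ?orbT// tau_gt0.
have c1 : 0 <= s%:R * (`|bq a b|%:R + `|d / c|) :> R by rewrite mulr_ge0// addr_ge0.
have nB : s%:R * (`|bq a b|%:R + `|d / c|) <= n%:R :> R.
  apply: le_trans (ltW (archi_boundP c1)) _; rewrite ler_nat.
  by apply: leq_trans (ltnW tn); rewrite /t; lia.
have bB : (bq a b)%:~R <= `|bq a b|%:R :> R.
  by rewrite natr_absz ler_int ler_norm.
have eB : - (d / c) <= `|d / c| by have := ler_norm (- (d / c)); rewrite normrN.
have {}sw : s%:R * (weight a b n)%:R <= (s%:R - 1) * ((aq a b)%:R * n%:R + (bq a b)%:~R) :> R.
  rewrite -rnE -[rn a b n]gez0_abs ?(ltW r0)//.
  have -> : s%:R - 1 = s.-1%:R :> R by rewrite -subn1 natrB// prime_gt0.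
  by rewrite -pmulrn -!natrM ler_nat.
have q1 : (1 : R) <= (aq a b)%:R by rewrite ler1n.
have s1R : (1 : R) <= s%:R by rewrite ler1n prime_gt0.
have b0 : (0 : R) <= `|bq a b|%:R by [].
rewrite lerBlDr ler_pdivrMr// -(ler_pM2l sR).
move: sw nB bB eB q1 s1R b0.
move: (weight a b n)%:R (d / c) (`|d / c|) (aq a b)%:R => W e e' q.
move: (bq a b)%:~R (`|bq a b|%N%:R) n%:R => bb b' x.
move: sR; move: s%:R => y y0 sw nB bB eB q1 y1 b0.
apply: le_trans sw _; rewrite -subr_ge0.
have h1 : q * (y * (b' + e')) <= q * x by apply: ler_wpM2l => //; lra.
have h2 : (y - 1) * bb <= q * (y * b').
  apply: (@le_trans _ _ ((y - 1) * b')); first by apply: ler_wpM2l => //; lra.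
  rewrite mulrA ler_wpM2r//; apply: (@le_trans _ _ y); first by lra.
  by rewrite ler_peMl// ltW.
have h3 : - (y * (q * e)) <= q * (y * e').
  have yq : 0 <= y * q by apply: mulr_ge0; lra.
  have := ler_wpM2l yq eB; lra.
lra.
Qed.

(** * Infinitely many prime values *)

(** Dirichlet's theorem applies to [a'] and [b'], which are coprime. The lower bound on
    the prime [p] makes the index [(p - b') / a'] exceed [N], and [p] exceed [g]. *)
Lemma Pset_infinite (R : realType) (a : nat) (b : int) :
  (0 < a)%N -> infinite_set (Pset a b).
Proof.
move=> a0; apply: infinite_set_unbounded => N.
have q0 := aq_gt0 b a0.
have qz : (aq a b)%:Z != 0 by rewrite -lt0n in q0 *; lia.
pose h := `|(bq a b %% (aq a b)%:Z)%Z|%N.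
have hE : h%:Z = (bq a b %% (aq a b)%:Z)%Z by rewrite /h gez0_abs// modz_ge0.
have qh : coprime (aq a b) h.
  have := coprime_aq_bq b a0.
  rewrite -[coprime _ `|_|]/(coprimez (aq a b)%:Z _).
  rewrite -[coprime _ _]/(coprimez (aq a b)%:Z h%:Z).
  by rewrite hE /coprimez gcdz_modr.
have [p [pp Bp ph]] := dirichlet_primes R
  (aq a b * N + `|bq a b| + gg a b)%N q0 qh.
have dv : ((aq a b)%:Z %| p%:Z - bq a b)%Z.
  by rewrite -eqz_mod_dvd modz_nat ph -modz_nat hE modz_mod.
have /dvdzP[m mE] := dv.
have mN : N%:Z < m by nia.
exists `|m|%N; last by lia.
have rnp : rn a b `|m| = p%:Z.
  by rewrite /rn gez0_abs; [rewrite mulrC -mE subrK | lia].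
split; first by lia.
rewrite rnp; split; first by rewrite ltz_nat prime_gt0.
move=> /= /dvdn_leq; rewrite gg_gt0// => /(_ isT) hh; lia.
Qed.

Lemma rho_ge1P (R : realType) (a : nat) (b : int) :
  reflect (exists n, Rset R a b n) (1 <= rho R a b)%E.
Proof.
rewrite /rho /counting; case: asboolP => [fin|inf]; last first.
  by rewrite leey; apply: ReflectT; have [n An] := infinite_setN0 inf; exists n.
rewrite lee_fin ler1n finmap.cardfs_gt0; apply: (iffP (finmap.fset0Pn _)) => -[n An].
  by exists n; move: An; rewrite in_fset_set// => /set_mem.
by exists n; rewrite in_fset_set//; apply/mem_set.
Qed.

Local Open Scope classical_set_scope.
Local Open Scope ring_scope.

Theorem theorem23 (R : realType) (a : nat) (b : int) (c d : R)
    (ha : (0 < a)%N) (hc : 0 < c) :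
  Rset R a b `|` R'set R a b = Nabove (- (b%:~R / a%:R) : R) /\
  (* (i) *)
  (infinite_set (Mset a b c d) /\
   Mset a b c d =
     [set n | [/\ (0 < n)%N, - (b%:~R / a%:R) < n%:R :> R &
        (gamma (gg a b)%:Z (rn a b n))%:R
          * (totient (tau (gg a b)%:Z (rn a b n)))%:R / (aq a b)%:R - d / c
        <= n%:R]]) /\
  (* (ii) *)
  (infinite_set (Pset a b) /\
   Pset a b `<=` R'set R a b /\
   (Mset a b c d `&` Rset R a b !=set0 -> b%:~R / a%:R <= d / c) /\
   (b%:~R / a%:R <= d / c ->
      Mset a b c d = Nabove (- (b%:~R / a%:R) : R)) /\
   (Mset a b c d `&` Pset a b !=set0 ->
      (b - (gg a b)%:Z)%:~R / a%:R <= d / c) /\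
   ((b - (gg a b)%:Z)%:~R / a%:R <= d / c ->
      R'set R a b `<=` Mset a b c d)) /\
  (* (iii) *)
  (Mset a b c d = Nabove (- (b%:~R / a%:R) : R) <->
   (if (1 <= rho R a b)%E then b%:~R / a%:R
    else (b - (gg a b)%:Z)%:~R / a%:R) <= d / c).
Proof.
have qR : (0 : R) < (aq a b)%:R by rewrite ltr0n aq_gt0.
have NaboveP n : Nabove (- (b%:~R / a%:R) : R) n <-> (0 < n)%N /\ 0 < rn a b n.
  by rewrite /Nabove /= Nabove_rn.
have RR' : Rset R a b `|` R'set R a b = Nabove (- (b%:~R / a%:R) : R).
  apply/seteqP; split => [n [[]|[]]//|n nN].
  have /NaboveP[_ r0] := nN; have r0' : rn a b n != 0 by rewrite gt_eqF.
  have := rad_dvd_tau (gg a b) r0'; case: (boolP (rad _ %| _)%N) => h.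
    by left.
  by move/esym/negbFE => t2; right.
have M_sub : Mset a b c d `<=` Nabove (- (b%:~R / a%:R) : R).
  by move=> n /(MsetP _ _ _ ha hc)[n0 r0 _]; apply/NaboveP.
have rR n : 0 < rn a b n -> `|rn a b n|%N%:R = (aq a b)%:R * n%:R + (bq a b)%:~R :> R.
  by move=> r0; rewrite -rnE -{2}[rn a b n]gez0_abs ?ltW.
have P_R' : Pset a b `<=` R'set R a b.
  move=> n nP; have [tE _] := Pset_tau nP; move: nP => [n0 [[r0 rp] _]].
  by split; [apply/NaboveP | rewrite tE; exact: prime_gt1].
have MR : Mset a b c d `&` Rset R a b !=set0 -> b%:~R / a%:R <= d / c.
  move=> [n [/(MsetP _ _ _ ha hc)[n0 r0 h] [_ rad_g]]].
  move: h; rewrite weight_Rset// rR// mulrDl mulrAC mulfV ?gt_eqF// mul1r.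
  by rewrite -ratio_bq//; lra.
have M_all : b%:~R / a%:R <= d / c -> Mset a b c d = Nabove (- (b%:~R / a%:R) : R).
  move=> bd; apply/seteqP; split=> // n /NaboveP[n0 r0]; apply/(MsetP _ _ _ ha hc).
  split => //; rewrite lerBlDr; apply: (@le_trans _ _ (`|rn a b n|%N%:R / (aq a b)%:R)).
    by rewrite ler_wpM2r ?invr_ge0 ?(ltW qR)// ler_nat weight_le.
  rewrite rR// mulrDl mulrAC mulfV ?gt_eqF// mul1r -ratio_bq//; lra.
have MP : Mset a b c d `&` Pset a b !=set0 -> (b - (gg a b)%:Z)%:~R / a%:R <= d / c.
  move=> [n [/(MsetP _ _ _ ha hc)[n0 r0 h] nP]].
  have [tE cE] := Pset_tau nP; have [_ [[_ rp] _]] := nP.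
  move: h; rewrite /weight tE cE mul1n totient_prime// -subn1 natrB ?prime_gt0//.
  rewrite rR// -addrA mulrDl mulrAC mulfV ?gt_eqF// mul1r -ratio_bq1//; lra.
have R'M : (b - (gg a b)%:Z)%:~R / a%:R <= d / c -> R'set R a b `<=` Mset a b c d.
  move=> bd n [/NaboveP[n0 r0] t2]; apply/(MsetP _ _ _ ha hc).
  split => //; rewrite lerBlDr.
  apply: (@le_trans _ _ ((`|rn a b n|%N%:R - 1) / (aq a b)%:R)).
    rewrite ler_wpM2r ?invr_ge0 ?(ltW qR)// lerBrDr natr1 ler_nat.
    exact: weight_lt.
  rewrite rR// -addrA mulrDl mulrAC mulfV ?gt_eqF// mul1r -ratio_bq1//; lra.
have P_inf : infinite_set (Pset a b) := @Pset_infinite R a b ha.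
split=> //; split.
  split; first exact: Mset_infinite.
  apply/seteqP; split=> n.
    move=> /(MsetP _ _ _ ha hc)[n0 r0 h]; split => //; first by rewrite Nabove_rn.
    by rewrite -natrM.
  move=> [n0]; rewrite Nabove_rn// -natrM => r0 h.
  by apply/(MsetP _ _ _ ha hc); split.
split; first exact: (conj P_inf (conj P_R' (conj MR (conj M_all (conj MP R'M))))).
split=> [ME|].
  case: rho_ge1P => [[n Rn]|_].
    by apply: MR; exists n; split => //; rewrite ME; case: Rn.
  have [p Pp] := infinite_setN0 P_inf.
  by apply: MP; exists p; split => //; rewrite ME; have [] := P_R' p Pp.
case: rho_ge1P => [_|no]; first exact: M_all.
move=> /R'M R'sub; apply/seteqP; split => // n; rewrite -RR' => -[Rn|/R'sub//].
by case: no; exists n.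
Qed.
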